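(* Let $\Phi:\mathbb{R}^d\times\mathbb{R}^n\to\mathbb{R}$, $f:\mathbb{R}^d\to\mathbb{R}\cup\{+\infty\}$, $h:\mathbb{R}^n\to\mathbb{R}\cup\{+\infty\}$ satisfy: (1) for every $x\in\mathbb{R}^d$, $\Phi(x,\cdot)$ is concave and differentiable with $\|\nabla_y\Phi(x,y)-\nabla_y\Phi(x,y')\|\le L_{\nabla\Phi}\|y-y'\|$ for all $y,y'\in\mathbb{R}^n$; (2) for every $y\in\mathbb{R}^n$, $\Phi(\cdot,y)+\frac{\rho}{2}\|\cdot\|^2$ is convex; (3) $|\Phi(x,y)-\Phi(x',y)|\le L\|x-x'\|$ for all $x,x'\in\mathbb{R}^d$ and $y\in\operatorname{dom}h$; (4) $f$ and $h$ are proper, lower semicontinuous and convex; $f$ is either $L_f$-Lipschitz continuous on its domain, which is assumed open, or the indicator function of a nonempty closed convex set (either of which guarantees $\|\operatorname{prox}_{\gamma f}(x)-x\|\le\gamma L_f$ for all $x\in\operatorname{dom}f$, $\gamma>0$); $\operatorname{dom}h$ is bounded with diameter at most $D_h$; (5) $\inf_{x\in\mathbb{R}^d}\psi(x)>-\infty$, where $\psi(x):=f(x)+\max_{y\in\mathbb{R}^n}\{\Phi(x,y)-h(y)\}$; (6) $\Phi(x,y)=\mathbb{E}_{\xi\sim\mathcal{D}}[\Phi(x,y;\xi)]$, and the stochastic (sub)gradients are unbiased with variance bounded by $\sigma^2\ge0$: for all $(x,y)$, $\mathbb{E}[\nabla_y\Phi(x,y;\zeta)]=\nabla_y\Phi(x,y)$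 and $\mathbb{E}\|\nabla_y\Phi(x,y;\zeta)-\nabla_y\Phi(x,y)\|^2\le\sigma^2$, and the stochastic subgradients $g^\xi\in\partial[\Phi(\cdot,y;\xi)](x)$ satisfy $\mathbb{E}[g^\xi]\in\partial[\Phi(\cdot,y)](x)$ and $\mathbb{E}\|g^\xi-\mathbb{E}[g^\xi]\|^2\le\sigma^2$. Given $(x_0,y_0)\in\operatorname{dom}f\times\operatorname{dom}h$, consider for $k\ge0$ $$x_{k+1}=\operatorname{prox}_{\eta_xf}(x_k-\eta_xg_k^\xi),\qquad y_{k+1}=\operatorname{prox}_{\eta_yh}\big(y_k+\eta_y\nabla_y\Phi(x_{k+1},y_k;\zeta_k)\big),$$ with $g_k^\xi\in\partial[\Phi(\cdot,y_k;\xi_k)](x_k)$ and $\xi_k,\zeta_k\sim\mathcal{D}$ independent of all previous iterates, with step sizes $$\eta_x=\min\left\{\frac{\epsilon^2}{\rho(L^2+\sigma^2)},\ \frac{\epsilon^4}{\rho^2L(L+L_f+\sigma)D_h^2L_{\nabla\Phi}},\ \frac{\epsilon^6}{\rho^3L(L+L_f+\sigma)\sigma^2D_h^2}\right\},\qquad \eta_y=\min\left\{\frac{1}{2L_{\nabla\Phi}},\frac{\epsilon^2}{\rho\sigma^2}\right\},$$ and let $\lambda=\frac{1}{2\rho}$. Then the number $K$ of stochastic gradient evaluations required to visit an $\epsilon$-stationary point in expectation, in the sense that $\min_{1\le k\le K}\mathbb{E}[\|\nabla\psi_\lambda(x_k)\|]\le\epsilon$, is $$\mathcal{O}\left(\frac{\Delta^*(L^2+L_f^2+\sigma^2)\rho}{\epsilon^4}\max\left\{1,\frac{\rho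 L_{\nabla\Phi}D_h^2}{\epsilon^2},\frac{\rho^2D_h^2\sigma^2}{\epsilon^4}\right\}+\frac{\Delta_0\rho}{\epsilon^2}\right),$$ where $\Delta^*=\psi(x_0)-\inf_{x\in\mathbb{R}^d}\psi(x)$ and $\Delta_0=\psi(x_0)-\Psi(x_0,y_0)$ with $\Psi(x,y):=f(x)+\Phi(x,y)-h(y)$.
   Context: $\mathcal{O}(\cdot)$ hides absolute numerical constants. For a function $u$, $\operatorname{prox}_{\gamma u}(x):=\arg\min_z\{u(z)+\frac{1}{2\gamma}\|z-x\|^2\}$. $\partial$ denotes the Fréchet subdifferential: $v\in\partial u(\bar x)$ iff $u(\bar x)$ is finite and $u(x)\ge u(\bar x)+\langle v,x-\bar x\rangle+o(\|x-\bar x\|)$ as $x\to\bar x$. A function $u$ is $\rho$-weakly convex if $u+\frac{\rho}{2}\|\cdot\|^2$ is convex. The Moreau envelope of a proper, lower semicontinuous, $\rho$-weakly convex $\psi$ with parameter $\lambda\in(0,\rho^{-1})$ is $\psi_\lambda(x):=\inf_z\{\psi(z)+\frac{1}{2\lambda}\|z-x\|^2\}$; it is continuously differentiable. Under the hypotheses $\psi$ is $\rho$-weakly convex. A point $x$ is $\epsilon$-stationary for $\psi$ (with parameter $\lambda$) if $\|\nabla\psi_\lambda(x)\|\le\epsilon$. Fractions with denominator $0$ (e.g. when $\sigma=0$) are read as $+\infty$. $\epsilon>0$ is the target accuracy.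
   Formalization: Accuracy ε with the displayed step sizes fails in general; proved instead, for an absolute constant A: the displayed step sizes reach accuracy Aε, and the step sizes with ε/A in place of ε reach accuracy ε. The bound on K is a constant times the displayed complexity, plus 1. *)

(* Defs.v *)
From HB Require Import structures.
From mathcomp Require Import all_boot all_order all_algebra.
From mathcomp Require Import all_classical all_reals all_analysis.

Set Implicit Arguments.
Unset Strict Implicit.
Unset Printing Implicit Defensive.
Import Order.TTheory GRing.Theory Num.Theory.
Import numFieldNormedType.Exports.

Local Open Scope classical_set_scope.
Local Open Scope ring_scope.

(* The library norm `|x| on 'rV[R]_n is the sup norm. It is used here only
   through the topology, which is the Euclidean one; every norm in a formula
   below is the Euclidean norm enorm. *)
Section Euclidean.
Context {R : realType} {n : nat}.

Definition dotv (u v : 'rV[R]_n) : R := \sum_(i < n) u 0 i * v 0 i.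

Definition enorm (u : 'rV[R]_n) : R := Num.sqrt (dotv u u).

Definition grad (u : 'rV[R]_n -> R) (x : 'rV[R]_n) : 'rV[R]_n :=
  \row_i 'D_(delta_mx 0 i) u x.

End Euclidean.

Section ExtendedRealFunctions.
Context {R : realType} {n : nat}.
Implicit Types (u : 'rV[R]_n -> \bar R) (x v : 'rV[R]_n).
Local Open Scope ereal_scope.

Definition dom u : set 'rV[R]_n := [set x | u x < +oo].

Definition proper_fun u : Prop := dom u !=set0 /\ forall x, -oo < u x.

(* Meant for u > -oo, where all the sums below are defined; 0 * +oo = 0. *)
Definition convex_efun u : Prop :=
  forall x y (t : R), (0 <= t <= 1)%R ->
    u (t *: x + (1 - t) *: y)%R <= t%:E * u x + (1 - t)%:E * u y.

Definition proper_lsc_convex u : Prop :=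
  [/\ proper_fun u, lower_semicontinuous u & convex_efun u].

Definition indicator_fun (C : set 'rV[R]_n) x : \bar R :=
  if x \in C then 0 else +oo.

Definition lipschitz_on_dom (Lf : R) u : Prop :=
  forall x x', dom u x -> dom u x' ->
    `|u x - u x'| <= (Lf * enorm (x - x'))%:E.

(* The o(|z - x|) term is written out in epsilon form. *)
Definition frechet_subdiff u x : set 'rV[R]_n :=
  [set v | u x \is a fin_num /\
    forall e : R, (0 < e)%R ->
      \forall z \near x,
        u x + (dotv v (z - x)%R)%:E - (e * enorm (z - x))%:E <= u z].

Definition argmin u : set 'rV[R]_n := [set z | forall w, u z <= u w].

Definition prox (gamma : R) u x : 'rV[R]_n :=
  get (argmin (fun z => u z + ((2 * gamma)^-1 * enorm (z - x) ^+ 2)%:E)).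

Definition moreau (lambda : R) u x : \bar R :=
  ereal_inf (range (fun z => u z + ((2 * lambda)^-1 * enorm (z - x) ^+ 2)%:E)).

(* fine turns the (finite) values of the envelope into real numbers. *)
Definition grad_moreau (lambda : R) u x : 'rV[R]_n :=
  grad (fun z => fine (moreau lambda u z)) x.

End ExtendedRealFunctions.

Section Minimax.
Context {R : realType} {d n : nat}.
Variables (Phi : 'rV[R]_d -> 'rV[R]_n -> R).
Variables (f : 'rV[R]_d -> \bar R) (h : 'rV[R]_n -> \bar R).
Local Open Scope ereal_scope.

(* The maximum over y is a supremum here; it is attained for the h considered,
   whose sublevel sets are compact. *)
Definition primal (x : 'rV[R]_d) : \bar R :=
  f x + ereal_sup (range (fun y => (Phi x y)%:E - h y)).

Definition saddle (x : 'rV[R]_d) (y : 'rV[R]_n) : \bar R :=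
  f x + (Phi x y)%:E - h y.

End Minimax.

Section Randomness.
Context {R : realType}.

(* R^n with its Borel sigma-algebra *)
Definition borelV (n : nat) := g_sigma_algebraType (@open 'rV[R]_n).

(* [joint_measurable F]: every coordinate of F(x, y; xi) is measurable for the
   product of the two Borel sigma-algebras and that of the sample space. *)
Definition joint_measurable (d n m : nat) dX (Xi : measurableType dX)
    (F : 'rV[R]_d -> 'rV[R]_n -> Xi -> 'rV[R]_m) : Prop :=
  forall i : 'I_m,
    measurable_fun [set: borelV d * borelV n * Xi]
      (fun p : borelV d * borelV n * Xi => F p.1.1 p.1.2 p.2 0 i).

Context {dT : measure_display} {T : measurableType dT}.
Variable P : probability T R.

Definition integrable_vec (n : nat) (v : T -> 'rV[R]_n) : Prop :=
  forall i : 'I_n, P.-integrable setT (fun w => (v w 0 i)%:E).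

Definition mean_vec (n : nat) (v : T -> 'rV[R]_n) : 'rV[R]_n :=
  \row_i fine ('E_P[fun w => v w 0%R i])%E.

(* E|v - m|^2 *)
Definition mean_sqdist (n : nat) (v : T -> 'rV[R]_n) (m : 'rV[R]_n) : \bar R :=
  ('E_P[fun w => (enorm (v w - m) ^+ 2)%R])%E.

(* The events {x_i in U}, i <= p, and {y_j in V}, j <= q, with U, V open: they
   generate the sigma-algebra of (x_0, ..., x_p, y_0, ..., y_q). *)
Definition history (d n : nat) (x : nat -> T -> 'rV[R]_d)
    (y : nat -> T -> 'rV[R]_n) (p q : nat) : set (set T) :=
  [set B | (exists i (U : set 'rV[R]_d),
              [/\ (i <= p)%N, open U & B = x i @^-1` U]) \/
           (exists j (V : set 'rV[R]_n),
              [/\ (j <= q)%N, open V & B = y j @^-1` V])].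

Definition independent_of dX (Xi : measurableType dX) (X : T -> Xi)
    (S : set (set T)) : Prop :=
  forall (A : set Xi) (B : set T), measurable A -> <<s S >> B ->
    P (X @^-1` A `&` B) = (P (X @^-1` A) * P B)%E.

End Randomness.

Section StepSizes.
Context {R : realType}.
Implicit Types eps rho L Lf Lphi Dh sigma : R.

Definition frac (a b : R) : \bar R := if b == 0 then +oo%E else (a / b)%:E.

Definition stepx eps rho L Lf Lphi Dh sigma : \bar R :=
  Order.min (frac (eps ^+ 2) (rho * (L ^+ 2 + sigma ^+ 2)))
    (Order.min
      (frac (eps ^+ 4) (rho ^+ 2 * L * (L + Lf + sigma) * Dh ^+ 2 * Lphi))
      (frac (eps ^+ 6)
            (rho ^+ 3 * L * (L + Lf + sigma) * sigma ^+ 2 * Dh ^+ 2))).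

Definition stepy eps rho Lphi sigma : \bar R :=
  Order.min (frac 1 (2 * Lphi)) (frac (eps ^+ 2) (rho * sigma ^+ 2)).

Definition complexity (Dstar D0 : \bar R) eps rho L Lf Lphi Dh sigma : \bar R :=
  (Dstar * ((L ^+ 2 + Lf ^+ 2 + sigma ^+ 2) * rho / eps ^+ 4)%:E
     * (Num.max 1 (Num.max (rho * Lphi * Dh ^+ 2 / eps ^+ 2)
                    (rho ^+ 2 * Dh ^+ 2 * sigma ^+ 2 / eps ^+ 4)))%:E
   + D0 * (rho / eps ^+ 2)%:E)%E.

End StepSizes.

(* Main.v *)
Require Import Defs.
From HB Require Import structures.
From mathcomp Require Import all_boot all_order all_algebra.
From mathcomp Require Import all_classical all_reals all_analysis.
From mathcomp Require Import measurable_realfun ring lra.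

Set Implicit Arguments.
Unset Strict Implicit.
Unset Printing Implicit Defensive.
Import Order.TTheory GRing.Theory Num.Theory.
Import numFieldNormedType.Exports.

Local Open Scope classical_set_scope.
Local Open Scope ring_scope.

(* Write psi = f + phi with phi = max_y (Phi - h), which is L-Lipschitz and rho-weakly
   convex, and z(x) for the proximal point of psi at x, so that the gradient of the
   envelope is 2 rho (x - z(x)). Let e be the accuracy entering the step sizes, and
   Delta* = psi(x0) - inf psi.

   Testing the proximal step against z(x_k) gives
     E psi_lambda(x_{k+1}) + eta_x rho^2 E|x_k - z(x_k)|^2
       <= E psi_lambda(x_k) + 2 rho eta_x Gamma_k + O(rho eta_x^2 (L^2 + sigma^2))
   as soon as eta_x rho <= 1/4, where Gamma_k is the expected duality gap at (x_k, y_k).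
   The ascent steps bound the gaps over a block of B steps, by comparison with a fixed
   near-maximizer. This needs the total number of steps to exceed B, which is not
   automatic, whence the cases:
   - rho Delta* <= e^2: x_1 is already nearly stationary;
   - L <= 2 e: Gamma_k can be replaced by 2 L^2 / rho, without any reference to y. If
     moreover eta_x rho > 1/4, then L^2 + sigma^2 <= 4 e^2 and plain descent of psi,
     which controls the distance from x_{k+1} to z(x_{k+1}), is enough;
   - otherwise eta_x rho <= 1/4 and B <= Delta* / (eta_x e^2) + 1.

   Noise is averaged out by Fubini-Tonelli against the sigma-algebra of the past, so
   that only nonnegative functions are integrated over Omega. *)

(** * Euclidean space *)

(** No single gap is shown to be small: x drifts while y climbs, so the gaps are controlled only on
    average, and the stationary index is found by averaging over all steps at the very end. No
    moment bound on the iterates is available beforehand. Hence all expectations are extended reals,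
    [psi] and its envelope are shifted by a lower bound [m], and recursions carry sums on both
    sides, because a possibly infinite term cannot be subtracted. The points with which the iterates
    are compared must be Borel functions of the past. Therefore minimizers of strongly convex
    functions are used throughout: they are unique and depend continuously on their data. Origin of
    the constants: per step, the average of rho^2 |x - z(x)|^2 is at most 6 e^2 near a minimizer, 38
    e^2 for small steps and 84 e^2 for large ones. The common bound 100 e^2 is rounded to a perfect
    square, and the squared gradient of the envelope is four times as large, whence 20 = 2 * 10. *)

Section EuclideanTheory.
Context {R : realType} {n : nat}.
Implicit Types (u v w x y z : 'rV[R]_n) (a t : R).

Lemma dotvC u v : dotv u v = dotv v u.
Proof. by apply: eq_bigr => i _; rewrite mulrC. Qed.

Lemma dotvDl u v w : dotv (u + v) w = dotv u w + dotv v w.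
Proof. by rewrite -big_split; apply: eq_bigr => i _; rewrite mxE mulrDl. Qed.

Lemma dotvDr u v w : dotv w (u + v) = dotv w u + dotv w v.
Proof. by rewrite dotvC dotvDl !(dotvC w). Qed.

Lemma dotvZl a u v : dotv (a *: u) v = a * dotv u v.
Proof. by rewrite /dotv mulr_sumr; apply: eq_bigr => i _; rewrite mxE mulrA. Qed.

Lemma dotvZr a u v : dotv u (a *: v) = a * dotv u v.
Proof. by rewrite dotvC dotvZl dotvC. Qed.

Lemma dotvNl u v : dotv (- u) v = - dotv u v.
Proof. by rewrite -scaleN1r dotvZl mulN1r. Qed.

Lemma dotvNr u v : dotv u (- v) = - dotv u v.
Proof. by rewrite dotvC dotvNl dotvC. Qed.

Lemma dotv0l v : dotv 0 v = 0.
Proof. by rewrite -(scale0r 0) dotvZl mul0r. Qed.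

Definition dotv_linE := (dotvDl, dotvDr, dotvNl, dotvNr, dotvZl, dotvZr).

Lemma dotvv_ge0 u : 0 <= dotv u u.
Proof. by apply: sumr_ge0 => i _; rewrite -expr2 sqr_ge0. Qed.

Lemma enorm_ge0 u : 0 <= enorm u.
Proof. exact: sqrtr_ge0. Qed.

Lemma enorm_sqr u : enorm u ^+ 2 = dotv u u.
Proof. by rewrite sqr_sqrtr// dotvv_ge0. Qed.

Lemma enorm_le u a : 0 <= a -> dotv u u <= a ^+ 2 -> enorm u <= a.
Proof.
move=> a0 ua; rewrite -(ger0_norm a0) -sqrtr_sqr; exact: ler_wsqrtr.
Qed.

Lemma coord_le_enorm u i : `|u 0 i| <= enorm u.
Proof.
rewrite -sqrtr_sqr ler_wsqrtr// /dotv (bigD1 i)//= -expr2 lerDl.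
by apply: sumr_ge0 => j _; rewrite -expr2 sqr_ge0.
Qed.

Lemma enorm0_eq0 u : enorm u = 0 -> u = 0.
Proof.
move=> u0; apply/rowP => i; apply/eqP; rewrite mxE -normr_le0 -u0.
exact: coord_le_enorm.
Qed.

Lemma enormZ a u : enorm (a *: u) = `|a| * enorm u.
Proof.
by rewrite /enorm dotvZl dotvZr mulrA -expr2 sqrtrM ?sqr_ge0// sqrtr_sqr.
Qed.

Lemma enormN u : enorm (- u) = enorm u.
Proof. by rewrite -scaleN1r enormZ normrN1 mul1r. Qed.

Lemma enormB u v : enorm (u - v) = enorm (v - u).
Proof. by rewrite -enormN opprB. Qed.

Lemma enorm0 : enorm (0 : 'rV[R]_n) = 0.
Proof. by rewrite /enorm dotv0l sqrtr0. Qed.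

Lemma dotv_le u v : dotv u v <= enorm u * enorm v.
Proof.
have [v0|v0] := eqVneq (enorm v) 0.
  by rewrite (enorm0_eq0 v0) dotvC dotv0l enorm0 mulr0.
have vp : 0 < enorm v by rewrite lt_def v0 enorm_ge0.
have [u0|u0] := eqVneq (enorm u) 0.
  by rewrite (enorm0_eq0 u0) dotv0l enorm0 mul0r.
have up : 0 < enorm u by rewrite lt_def u0 enorm_ge0.
have := dotvv_ge0 (enorm v *: u - enorm u *: v).
rewrite !dotv_linE (dotvC v u) -!enorm_sqr => H.
have {H} : 0 <= (enorm u * enorm v) * (enorm u * enorm v - dotv u v) by lra.
by rewrite pmulr_rge0 ?mulr_gt0// subr_ge0.
Qed.

Lemma ler_enormD u v : enorm (u + v) <= enorm u + enorm v.
Proof.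
apply: enorm_le; first by rewrite addr_ge0// enorm_ge0.
rewrite !dotv_linE (dotvC v u) -!enorm_sqr.
have := dotv_le u v; nra.
Qed.

Lemma ler_distenormD w u v : enorm (u - v) <= enorm (u - w) + enorm (w - v).
Proof. by rewrite (le_trans _ (ler_enormD _ _))// addrA subrK. Qed.

Lemma enorm_conv t x y z :
  enorm (t *: x + (1 - t) *: y - z) ^+ 2 =
  t * enorm (x - z) ^+ 2 + (1 - t) * enorm (y - z) ^+ 2
  - t * (1 - t) * enorm (x - y) ^+ 2.
Proof.
rewrite !enorm_sqr !dotv_linE (dotvC y x) (dotvC z x) (dotvC z y); ring.
Qed.

Lemma enorm_three_points x y z :
  enorm (z - x) ^+ 2 - enorm (z - y) ^+ 2 - enorm (y - x) ^+ 2 =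
  2 * dotv (z - y) (y - x).
Proof.
by rewrite !enorm_sqr !dotv_linE (dotvC y z) (dotvC x y) (dotvC x z); ring.
Qed.

Lemma normr_le_enorm u : `|u| <= enorm u.
Proof.
rewrite [leLHS]/Num.norm /= mx_normrE; apply/bigmax_leP; split; first exact: enorm_ge0.
by move=> [i j] _ /=; rewrite (ord1 i) coord_le_enorm.
Qed.

Lemma continuous_dotv (T : topologicalType) (F G : T -> 'rV[R]_n) :
  continuous F -> continuous G -> continuous (fun p => dotv (F p) (G p)).
Proof.
move=> cF cG; apply: (@continuous_big R^o _ +%R) => [|i _ p].
  by move=> p; exact: cvgD cvg_fst cvg_snd.
apply: cvgM.
  apply: (cvg_comp F (fun M : 'rV[R]_n => M 0 i)); [exact: cF|exact: coord_continuous].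
apply: (cvg_comp G (fun M : 'rV[R]_n => M 0 i)); [exact: cG|exact: coord_continuous].
Qed.

Lemma continuous_enorm : continuous (enorm : 'rV[R]_n -> R).
Proof.
move=> u; apply: (cvg_comp (fun v => dotv v v) Num.sqrt).
  by apply: (@continuous_dotv _ id id) => ?; exact: cvg_id.
exact: sqrt_continuous.
Qed.

Lemma continuous_enormB z : continuous (fun x => enorm (x - z)).
Proof.
move=> x; apply: (cvg_comp (fun x => x - z) enorm); last exact: continuous_enorm.
by apply: (@cvgB R _ _ (nbhs x) _ id (fun=> z) x z); [exact: cvg_id|exact: cvg_cst].
Qed.

Lemma near_enorm_lt x a : 0 < a -> \forall y \near x, enorm (y - x) < a.
Proof.
move=> a0; have := @continuous_enormB x x.
rewrite /continuous_at subrr enorm0 => /(@cvgrPdist_lt _ _ _ (nbhs x)) /(_ a a0).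
by apply: filterS => y; rewrite sub0r normrN; exact/le_lt_trans/ler_norm.
Qed.

Lemma nbhs_enorm_ball x (A : set 'rV[R]_n) :
  nbhs x A -> exists2 r, 0 < r & forall y, enorm (y - x) < r -> A y.
Proof.
move=> /nbhs_ballP[r /= r0 rA]; exists r => // y yr; apply: rA.
rewrite mx_norm_ball /ball_/= -normrN opprB.
exact: le_lt_trans (normr_le_enorm _) yr.
Qed.

Lemma enorm_lipschitz_continuous (c : 'rV[R]_n -> R) L :
  (forall x y, `|c x - c y| <= L * enorm (x - y)) -> continuous c.
Proof.
move=> cL x; apply/(@cvgrPdist_lt _ _ _ (nbhs x)) => e e0.
pose K := `|L| + 1; have K0 : 0 < K by rewrite ltr_wpDl.
have : \forall y \near x, enorm (y - x) < e / K.
  by apply: near_enorm_lt; rewrite divr_gt0.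
apply: filterS => y yx; rewrite (le_lt_trans (cL _ _))// enormB.
move: yx; rewrite ltr_pdivlMr//; apply: le_lt_trans.
rewrite mulrC ler_wpM2l ?enorm_ge0// (le_trans (ler_norm L))// lerDl//.
Qed.

End EuclideanTheory.

(** Maximizers of a strongly concave function perturbed by a Lipschitz term obey only such an
    estimate, of exponent 1/2. *)
Lemma enorm_holder_continuous {R : realType} n m (c : 'rV[R]_n -> 'rV[R]_m) (L : R) :
  (forall x y, enorm (c x - c y) ^+ 2 <= L * enorm (x - y)) -> continuous c.
Proof.
move=> cL x; apply/(@cvgrPdist_lt _ _ _ (nbhs x)) => e e0.
pose K := `|L| + 1; have K0 : 0 < K by rewrite ltr_wpDl.
have : \forall y \near x, enorm (y - x) < e ^+ 2 / K.
  by apply: near_enorm_lt; rewrite divr_gt0// exprn_gt0.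
apply: filterS => y yx.
suff : enorm (c x - c y) < e by exact: le_lt_trans (normr_le_enorm _).
rewrite -(@ltr_pXn2r _ 2)// ?nnegrE ?enorm_ge0 ?(ltW e0)//.
rewrite (le_lt_trans (cL _ _))// enormB.
move: yx; rewrite ltr_pdivlMr//; apply: le_lt_trans.
rewrite mulrC ler_wpM2l ?enorm_ge0// (le_trans (ler_norm L))// lerDl//.
Qed.

(** * Strongly and weakly convex functions *)

(** Limit t -> 0 in the form needed after dividing a convexity inequality by t: only 0 < t < 1 is
    available there. *)
Lemma ler_small_scale {R : realType} (a b c : R) :
  (forall t, 0 < t < 1 -> a <= b + t * c) -> a <= b.
Proof.
move=> H; rewrite leNgt; apply/negP => ab.
pose K := `|c| + 1; have K0 : 0 < K by rewrite ltr_wpDl.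
pose t := (a - b) / (2 * (a - b) + 2 * K).
have D0 : 0 < 2 * (a - b) + 2 * K by lra.
have tD : t * (2 * (a - b) + 2 * K) = a - b by rewrite /t divfK// gt_eqF.
have t0 : 0 < t by rewrite divr_gt0 ?subr_gt0.
have t1 : t < 1 by rewrite ltr_pdivrMr//; lra.
have /H : 0 < t < 1 by rewrite t0.
have : t * c <= t * K by rewrite ler_pM2l// (le_trans (ler_norm c))// lerDl.
have : 0 <= t * (a - b) by rewrite mulr_ge0 ?subr_ge0 ?ltW.
lra.
Qed.

Section ConvexModulus.
Context {R : realType} {n : nat}.
Implicit Types (c : 'rV[R]_n -> R) (e : 'rV[R]_n -> \bar R) (x y z : 'rV[R]_n).

(* Strong convexity for mu > 0, weak convexity for mu < 0. *)
Definition mod_convex (mu : R) c := forall x y t, 0 <= t <= 1 ->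
  c (t *: x + (1 - t) *: y) <=
    t * c x + (1 - t) * c y - mu / 2 * (t * (1 - t)) * enorm (x - y) ^+ 2.

Lemma mod_convexD mu nu c c' : mod_convex mu c -> mod_convex nu c' ->
  mod_convex (mu + nu) (fun x => c x + c' x).
Proof. by move=> cc cc' x y t t01; have := cc x y t t01; have := cc' x y t t01; lra. Qed.

Lemma mod_convex_sqdist a z : mod_convex (2 * a) (fun x => a * enorm (x - z) ^+ 2).
Proof. by move=> x y t _; rewrite enorm_conv; lra. Qed.

Lemma convex_function_mod_convex c :
  @convex_function R 'rV[R]_n setT c -> mod_convex 0 c.
Proof.
move=> cc x y t t01.
have := cc (Itv01 (proj1 (andP t01)) (proj2 (andP t01))) x y.
rewrite !inE => /(_ Logic.I Logic.I) H.
by apply: (le_trans H); rewrite !mul0r subr0; exact: lexx.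
Qed.

Section ProperLscConvex.
Variable e : 'rV[R]_n -> \bar R.
Hypothesis econv : proper_lsc_convex e.

Lemma dom_fineK x : dom e x -> (fine (e x))%:E = e x.
Proof.
move=> ex; have [[_ eN] _ _] := econv.
by rewrite fineK// fin_numElt eN.
Qed.

Lemma notin_dom x : ~ dom e x -> e x = +oo%E.
Proof. by move=> ex; apply/eqP; rewrite -leye_eq leNgt; apply/negP. Qed.

Lemma dom_conv x y t : 0 <= t <= 1 -> dom e x -> dom e y ->
  dom e (t *: x + (1 - t) *: y) /\
  fine (e (t *: x + (1 - t) *: y)) <= t * fine (e x) + (1 - t) * fine (e y).
Proof.
move=> t01 ex ey; have [_ _ cvx] := econv.
have := cvx x y t t01; rewrite -(dom_fineK ex) -(dom_fineK ey).
rewrite -!EFinM -EFinD => H.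
have d : dom e (t *: x + (1 - t) *: y) by rewrite /dom/= (le_lt_trans H)// ltry.
by split => //; move: H; rewrite -(dom_fineK d) lee_fin.
Qed.

Section Minimizer.
Variables (c : 'rV[R]_n -> R) (mu : R).
Hypotheses (ccont : continuous c) (mu0 : 0 < mu) (cmod : mod_convex mu c).

Let E z := fine (e z) + c z.

Let E_conv x y t : 0 <= t <= 1 -> dom e x -> dom e y ->
  dom e (t *: x + (1 - t) *: y) /\ E (t *: x + (1 - t) *: y) <=
    t * E x + (1 - t) * E y - mu / 2 * (t * (1 - t)) * enorm (x - y) ^+ 2.
Proof.
move=> t01 ex ey; have [d H] := dom_conv t01 ex ey; split => //.
by have := cmod x y t01; rewrite /E; lra.
Qed.

Let E_lsc x (b : R) : (dom e x -> b < E x) ->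
  exists2 r, 0 < r & forall z, enorm (z - x) < r -> dom e z -> b < E z.
Proof.
move=> bx; have [_ lsc _] := econv.
have [d [d0 dx]] : exists d, 0 < d /\ ((b - c x + d)%:E < e x)%E.
  have [ex|/notin_dom ->] := pselect (dom e x); last by exists 1; rewrite ltry.
  exists ((E x - b) / 2); have {}bx := bx ex.
  by split; [lra|rewrite -(dom_fineK ex) lte_fin; rewrite /E in bx *; lra].
have [V Vx VE] := lsc _ _ dx.
have /nbhs_enorm_ball[r r0 rV] : nbhs x (V `&` [set z | c x - d < c z]).
  apply: filterI => //.
  have /(@cvgrPdist_lt _ _ _ (nbhs x)) /(_ d d0) := @ccont x.
  by apply: filterS => z /=; rewrite ltr_norml => /andP[_]; lra.
exists r => // z /rV[/VE + zc] ez; rewrite -(dom_fineK ez) lte_fin /E.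
by rewrite /= in zc; lra.
Qed.

(** Lower semicontinuity keeps E above E x0 - 1 on a ball of radius r. On the segment from x0 to a
    far point z of the sublevel set, the point at distance r / 2 lies in this ball, yet strong
    convexity pushes its value down by mu r / 4 (N - r / 2); so this amount is below 1. *)
Let E_bounded x0 : dom e x0 -> exists M, forall z, dom e z -> E z <= E x0 ->
  enorm (z - x0) <= M.
Proof.
move=> ex0; have [|r r0 rE] := @E_lsc x0 (E x0 - 1); first by move=> _; lra.
have mr0 : 0 < mu * r by rewrite mulr_gt0.
exists (r + 4 / (mu * r)) => z ez zx0.
set N := enorm (z - x0).
have d0 : 0 < 4 / (mu * r) by rewrite divr_gt0.
have [Nr|rN] := ltP N r; first by lra.
have N0 : 0 < N by lra.
pose t := r / (2 * N).
have tN : t * N = r / 2 by rewrite /t; field; rewrite gt_eqF.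
have t0 : 0 < t by rewrite divr_gt0// mulr_gt0.
have t1 : t <= 1 / 2 by rewrite ler_pdivrMr ?mulr_gt0//; lra.
have t01 : 0 <= t <= 1 by apply/andP; split; lra.
have [dw Ew] := E_conv t01 ez ex0.
have /rE/(_ dw) : enorm (t *: z + (1 - t) *: x0 - x0) < r.
  rewrite (_ : _ - x0 = t *: (z - x0)); last first.
    by apply/rowP => i; rewrite !mxE; ring.
  by rewrite enormZ gtr0_norm// tN; lra.
rewrite -/N in Ew; move=> Ew'.
have q : mu / 2 * (t * (1 - t)) * N ^+ 2 = mu * r / 4 * (N - r / 2).
  transitivity (mu / 2 * (t * N) * (N - t * N)); first by ring.
  by rewrite tN; field.
have : mu * r / 4 * (N - r / 2) < 1.
  rewrite -q; have : t * E z <= t * E x0 by rewrite ler_pM2l.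
  lra.
have -> : mu * r / 4 * (N - r / 2) = (N - r / 2) / (4 / (mu * r)).
  by field; rewrite !gt_eqF.
by rewrite ltr_pdivrMr//; lra.
Qed.

Lemma exists_minimizer : exists p, dom e p /\
  forall z, dom e z -> E p + mu / 2 * enorm (z - p) ^+ 2 <= E z.
Proof.
(* Quadratic growth follows from minimality: compare p with t z + (1 - t) p, divide by t and let t
   tend to 0. *)
suff [p [ep pmin]] : exists p, dom e p /\ forall z, dom e z -> E p <= E z.
  exists p; split => // z ez.
  apply: (@ler_small_scale _ _ _ (mu / 2 * enorm (z - p) ^+ 2)) => t /andP[t0 t1].
  have t01 : 0 <= t <= 1 by rewrite !ltW.
  have [ew Ew] := E_conv t01 ez ep.
  have := le_trans (pmin _ ew) Ew => H.
  rewrite -(ler_pM2l t0); lra.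
have [[[x0 ex0] _] _ _] := econv.
have [M EM] := E_bounded ex0.
have [xmin|] := pselect (forall z, dom e z -> E x0 <= E z); first by exists x0.
move=> /existsNP[z0 /not_implyP[ez0 /negP]]; rewrite -ltNge => z0x0.
(* The filter generated by the nonempty strict sublevel sets; one of its cluster points is the
   minimizer. That [x0] is not minimal provides a nonempty one inside the compact ball. *)
pose F (A : set 'rV[R]_n) := exists b, (exists2 z, dom e z & E z < b) /\
  forall z, dom e z -> E z < b -> A z.
have FF : ProperFilter F.
  split; first by case=> b [[z ez zb]] /(_ z ez zb).
  split.
  - by exists (E x0); split => //; exists z0.
  - move=> A B [b [[z ez zb] bA]] [b' [[z' ez' zb'] bB]].
    exists (Num.min b b'); split.
      have [zz'|z'z] := leP (E z) (E z').
        by exists z => //; rewrite lt_min zb (le_lt_trans zz').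
      by exists z' => //; rewrite lt_min zb' (lt_trans z'z).
    by move=> w ew; rewrite lt_min => /andP[wb wb']; split; [exact: bA|exact: bB].
  - by move=> A B AB [b [H bA]]; exists b; split=> // z ez zb; apply: AB; exact: bA.
have cS : compact [set z | enorm (z - x0) <= M].
  apply: bounded_closed_compact.
    exists (`|x0| + M); split; first exact: num_real.
    move=> a aM z /= zM; rewrite (le_trans _ (ltW aM))//.
    rewrite -[z](subrK x0) (le_trans (ler_normD _ _))// addrC lerD2l.
    exact: le_trans (normr_le_enorm _) zM.
  have := @closed_comp _ _ (fun z => enorm (z - x0)) [set r | r <= M].
  by apply; [move=> z _; exact: continuous_enormB|exact: closed_le].
have [|p [pM pF]] := cS F FF.
  by exists (E x0); split; [exists z0|move=> z ez /ltW/(EM _ ez)].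
(* With E p read as [+oo] off the domain, this says that no z lies strictly below p; it yields both
   that p is in the domain and that p is minimal. *)
have pmin z : dom e z -> ~ (dom e p -> E z < E p).
  move=> ez H.
  have [b [zb bp]] : exists b, E z < b /\ (dom e p -> b < E p).
    have [ep|nep] := pselect (dom e p).
      by exists ((E z + E p) / 2); have := H ep; split => [|_]; lra.
    by exists (E z + 1); split => //; lra.
  have [r r0 rE] := E_lsc bp.
  have [] := pF [set w | dom e w /\ E w < b] [set w | enorm (w - p) < r].
  - by exists b; split; [exists z|move=> w ew wb].
  - exact: near_enorm_lt.
  - by move=> w [[ew wb] /rE /(_ ew)]; apply/negP; rewrite -leNgt ltW.
have ep : dom e p by apply: contrapT => nep; exact: (pmin x0 ex0).
exists p; split => // z ez; rewrite leNgt; apply/negP => H.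
exact: (pmin z ez).
Qed.

End Minimizer.

End ProperLscConvex.

End ConvexModulus.

(** * Proximal maps and subgradients *)

Section Argmin.
Context {R : realType} {n : nat}.
Implicit Types (e : 'rV[R]_n -> \bar R) (c : 'rV[R]_n -> R) (x y z : 'rV[R]_n).

(** Common form of [prox], of the proximal point of psi and of the smoothed maximizer. For strongly
    convex c the argmin is a singleton, so [get] makes no arbitrary choice. *)
Definition minpoint e c : 'rV[R]_n := get (argmin (fun z => e z + (c z)%:E)%E).

Lemma minpointP e c mu : proper_lsc_convex e -> continuous c -> 0 < mu ->
    mod_convex mu c ->
  dom e (minpoint e c) /\ forall z, dom e z ->
    fine (e (minpoint e c)) + c (minpoint e c) + mu / 2 * enorm (z - minpoint e c) ^+ 2
      <= fine (e z) + c z.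
Proof.
move=> econv cc mu0 cmod.
have [p [ep pmin]] := exists_minimizer econv cc mu0 cmod.
suff -> : minpoint e c = p by [].
have argE : argmin (fun z => e z + (c z)%:E)%E = [set p].
  apply/seteqP; split => [z zmin|_ -> z] /=; last first.
    have [ez|/(notin_dom) ->] := pselect (dom e z); last by rewrite addye// leey.
    rewrite -(dom_fineK econv ep) -(dom_fineK econv ez) -!EFinD lee_fin.
    apply: le_trans (pmin z ez).
    by rewrite lerDl mulr_ge0 ?sqr_ge0// divr_ge0// ltW.
  have := zmin p; have [ez|/(notin_dom) ->] := pselect (dom e z); last first.
    by rewrite addye// -(dom_fineK econv ep) -EFinD leNgt ltry.
  rewrite -(dom_fineK econv ep) -(dom_fineK econv ez) -!EFinD lee_fin => zp.
  have := le_trans (pmin z ez) zp.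
  have := sqr_ge0 (enorm (z - p)).
  rewrite le_eqVlt => /orP[/eqP/esym/eqP|zp0].
    by rewrite sqrf_eq0 => /eqP/enorm0_eq0/eqP; rewrite subr_eq0 => /eqP.
  have : 0 < mu / 2 * enorm (z - p) ^+ 2 by rewrite mulr_gt0// divr_gt0.
  by move=> *; exfalso; lra.
by rewrite /minpoint argE; apply: xget_unique => // q.
Qed.

Lemma continuous_sqdist a z : continuous (fun x => a * enorm (x - z) ^+ 2).
Proof.
move=> x; apply: (@cvgM R _ (nbhs x) _); first exact: cvg_cst.
by apply: (@cvgM R _ (nbhs x) _); exact: continuous_enormB.
Qed.

Section Prox.
Variables (e : 'rV[R]_n -> \bar R) (gamma : R).
Hypotheses (econv : proper_lsc_convex e) (gamma0 : 0 < gamma).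

Lemma proxP x : dom e (prox gamma e x) /\ forall z, dom e z ->
  fine (e (prox gamma e x)) + (2 * gamma)^-1 * enorm (prox gamma e x - x) ^+ 2
    + (2 * gamma)^-1 * enorm (z - prox gamma e x) ^+ 2
  <= fine (e z) + (2 * gamma)^-1 * enorm (z - x) ^+ 2.
Proof.
have g0 : 0 < (2 * gamma)^-1 by rewrite invr_gt0 mulr_gt0.
have m0 : 0 < 2 * (2 * gamma)^-1 by rewrite mulr_gt0.
have [d H] := minpointP econv (@continuous_sqdist (2 * gamma)^-1 x) m0
  (@mod_convex_sqdist _ _ _ x).
have aE : 2 * (2 * gamma)^-1 / 2 = (2 * gamma)^-1 by rewrite mulrAC divff// mul1r.
by split => // z /H; rewrite aE.
Qed.

(** Each proximal point is tested in the problem of the other; the sum of the two growth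
    inequalities is firm nonexpansiveness. It serves to make the updates Borel. *)
Lemma prox_nonexpansive x x' :
  enorm (prox gamma e x - prox gamma e x') <= enorm (x - x').
Proof.
have [ep H] := proxP x; have [ep' H'] := proxP x'.
move: (H _ ep') (H' _ ep); set p := prox _ _ x; set p' := prox _ _ x'.
have g0 : 0 < (2 * gamma)^-1 by rewrite invr_gt0 mulr_gt0.
set a := (2 * gamma)^-1 in g0 *.
clearbody p p' a; clear H H' ep ep' => H H'.
have : a * (2 * enorm (p - p') ^+ 2) <= a * (2 * dotv (p - p') (x - x')).
  move: H H'; rewrite !enorm_sqr !dotv_linE (dotvC p' p) (dotvC x p) (dotvC x p')
    (dotvC x' p) (dotvC x' p'); lra.
rewrite ler_pM2l// ler_pM2l// => K.
have [->|pp] := eqVneq (enorm (p - p')) 0; first exact: enorm_ge0.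
have pp0 : 0 < enorm (p - p') by rewrite lt_def pp enorm_ge0.
rewrite -(ler_pM2l pp0) -expr2 (le_trans K)// dotv_le//.
Qed.

Lemma continuous_prox : continuous (prox gamma e).
Proof.
move=> x; apply/(@cvgrPdist_lt _ _ _ (nbhs x)) => d d0.
have := near_enorm_lt x d0; apply: filterS => y yx.
have : enorm (prox gamma e x - prox gamma e y) < d.
  by rewrite (le_lt_trans (prox_nonexpansive _ _))// enormB.
exact: le_lt_trans (normr_le_enorm _).
Qed.

Lemma prox_step x g z (p := prox gamma e (x - gamma *: g)) : dom e z ->
  fine (e p) + dotv g (p - z) <= fine (e z)
    + (2 * gamma)^-1 * (enorm (z - x) ^+ 2 - enorm (z - p) ^+ 2 - enorm (p - x) ^+ 2).
Proof.
move=> ez; have [_ /(_ z ez)] := proxP (x - gamma *: g); rewrite -/p.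
have gE : (2 * gamma)^-1 * gamma = 2^-1 by rewrite invfM mulfVK// gt_eqF.
(* Recentring the square at x produces the linear term in g and a constant independent of w, which
   cancels between the two sides. *)
have q w : (2 * gamma)^-1 * enorm (w - (x - gamma *: g)) ^+ 2 =
  (2 * gamma)^-1 * enorm (w - x) ^+ 2 + dotv g (w - x)
    + 2^-1 * gamma * enorm g ^+ 2.
  rewrite opprB addrCA -gE !enorm_sqr.
  transitivity ((2 * gamma)^-1 * dotv (w - x) (w - x) +
    2 * ((2 * gamma)^-1 * gamma) * dotv g (w - x)
    + (2 * gamma)^-1 * gamma * gamma * dotv g g).
    by rewrite !dotv_linE (dotvC g w) (dotvC g x) (dotvC x w); ring.
  by rewrite gE divff// mul1r.
rewrite !q !dotv_linE; lra.
Qed.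

End Prox.

End Argmin.

Section Subgradients.
Context {R : realType} {n : nat}.
Implicit Types (F : 'rV[R]_n -> R) (x v w z : 'rV[R]_n).

Lemma frechet_subdiffP F x v : frechet_subdiff (fun z => (F z)%:E) x v ->
  forall a, 0 < a -> exists2 r, 0 < r & forall z, enorm (z - x) < r ->
    F x + dotv v (z - x) - a * enorm (z - x) <= F z.
Proof.
move=> [_ H] a a0; have /nbhs_enorm_ball[r r0 rH] := H a a0.
by exists r => // z /rH; rewrite -EFinD -EFinB lee_fin.
Qed.

(** The Fréchet inequality is local. Weak convexity carries it from a point near x on the segment
    towards z out to z itself, and the error a |z - x| vanishes with a. *)
Lemma frechet_weakly_convex F rho x v z : 0 <= rho -> mod_convex (- rho) F ->
  frechet_subdiff (fun z => (F z)%:E) x v ->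
  dotv v (z - x) <= F z - F x + rho / 2 * enorm (z - x) ^+ 2.
Proof.
move=> rho0 Fc /frechet_subdiffP Fv.
apply: (@ler_small_scale _ _ _ (enorm (z - x))) => a /andP[a0 _].
have [r r0 rF] := Fv a a0; set N := enorm (z - x).
have N0 : 0 <= N by exact: enorm_ge0.
pose t := r / (r + N + 1).
have D0 : 0 < r + N + 1 by lra.
have t0 : 0 < t by rewrite divr_gt0.
have t1 : t < 1 by rewrite ltr_pdivrMr//; lra.
have tN : t * N < r by rewrite /t mulrAC ltr_pdivrMr// ltr_pM2l//; lra.
have wE : t *: z + (1 - t) *: x - x = t *: (z - x).
  by apply/rowP => i; rewrite !mxE; ring.
have := rF (t *: z + (1 - t) *: x).
rewrite wE enormZ (gtr0_norm t0) dotvZr => /(_ tN) H.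
have t01 : 0 <= t <= 1 by rewrite !ltW.
have H' := Fc z x t t01.
have t' : 0 <= rho * t * t * N ^+ 2.
  apply: mulr_ge0 (sqr_ge0 _); apply: mulr_ge0 (ltW t0).
  exact: mulr_ge0 rho0 (ltW t0).
have : t * dotv v (z - x) <= t * (F z - F x + rho / 2 * N ^+ 2 + a * N).
  by move: H H'; rewrite -/N; lra.
by rewrite ler_pM2l.
Qed.

(** Test the subgradient along its own direction, at x + t v with t small. *)
Lemma frechet_lipschitz F L x v : 0 <= L ->
  (forall z, `|F z - F x| <= L * enorm (z - x)) ->
  frechet_subdiff (fun z => (F z)%:E) x v -> enorm v <= L.
Proof.
move=> L0 FL /frechet_subdiffP Fv.
apply: (@ler_small_scale _ _ _ 1) => a /andP[a0 _].
have [r r0 rF] := Fv a a0; set N := enorm v.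
have [N0|N0] := eqVneq N 0; first by rewrite N0 mulr1; lra.
have Np : 0 < N by rewrite lt_def N0 enorm_ge0.
pose t := r / (2 * N).
have t0 : 0 < t by rewrite divr_gt0// mulr_gt0.
have tN : t * N < r by rewrite /t -mulrA invfM mulfVK//; lra.
have := rF (x + t *: v); have := FL (x + t *: v).
rewrite addrAC subrr add0r enormZ (gtr0_norm t0) dotvZr -enorm_sqr -/N.
move=> H /(_ tN) H'; have {}H := le_trans (ler_norm _) H.
have : (t * N) * N <= (t * N) * (L + a * 1) by lra.
by rewrite ler_pM2l// mulr_gt0.
Qed.

End Subgradients.

Section SmoothConcave.
Context {R : realType} {n : nat}.
Implicit Types (F : 'rV[R]_n -> R) (x v w z : 'rV[R]_n).

Lemma derive_dotv_grad F x w : differentiable F x -> 'D_w F x = dotv (grad F x) w.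
Proof.
move=> dF; rewrite deriveE// {1}(row_sum_delta w) linear_sum /dotv.
by apply: eq_bigr => i _; rewrite linearZ /= mxE deriveE// mulrC.
Qed.

Lemma is_derive_line F v w (s : R) : differentiable F (v + s *: w) ->
  is_derive s 1 (fun s : R => F (v + s *: w)) (dotv (grad F (v + s *: w)) w).
Proof.
move=> dF; have E : (fun h : R => h^-1 *:
    (((fun s : R => F (v + s *: w)) \o shift s) (h *: 1) - F (v + s *: w))) =
    (fun h => h^-1 *: ((F \o shift (v + s *: w)) (h *: w) - F (v + s *: w))).
  apply/funext => h /=; congr (_ *: (F _ - _)).
  by rewrite scalerDl addrCA /GRing.scale/= mulr1.
split; first by rewrite /derivable E; exact: (diff_derivable dF).
by rewrite -derive_dotv_grad// /derive E.
Qed.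

(** The difference [r] between F and its quadratic minorant along the segment has a nonnegative
    derivative, by Cauchy-Schwarz and the Lipschitz gradient; the mean value theorem concludes. *)
Lemma smooth_lower_bound F Lphi v w : (forall v, differentiable F v) -> 0 <= Lphi ->
  (forall v v', enorm (grad F v - grad F v') <= Lphi * enorm (v - v')) ->
  F v + dotv (grad F v) w - Lphi / 2 * enorm w ^+ 2 <= F (v + w).
Proof.
move=> dF L0 gF.
pose r (s : R) := F (v + s *: w) + (- dotv (grad F v) w * s +
   (Lphi / 2 * enorm w ^+ 2) * s ^+ 2).
pose dr (s : R) := dotv (grad F (v + s *: w)) w + (- dotv (grad F v) w +
   Lphi * enorm w ^+ 2 * s).
have rD (s : R) : is_derive s 1 r (dr s).
  apply: is_deriveD; first exact/is_derive_line/dF.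
  apply: is_derive_eq.
  by rewrite /GRing.scale/= !mulr1; field.
have [] := @MVT_segment R r dr 0 1 ler01 (fun s _ => rD s).
  apply: derivable_within_continuous => s _; apply: ex_derive.
move=> s; rewrite in_itv/= => /andP[s0 s1].
rewrite /r scale0r scale1r addr0 subr0 mulr1 => E.
suff : 0 <= dr s by lra.
rewrite /dr; have := dotv_le (grad F v - grad F (v + s *: w)) w.
have := gF v (v + s *: w).
rewrite opprD addNKr enormN enormZ ger0_norm// => /(ler_wpM2r (enorm_ge0 w)).
by rewrite !dotv_linE; lra.
Qed.

(** Apply the quadratic bound to - F on the short segment t w, where its error is O(t^2), then
    extend to w by concavity and divide by t. *)
Lemma concave_upper_bound F Lphi v w : (forall v, differentiable F v) -> 0 <= Lphi ->
  (forall v v', enorm (grad F v - grad F v') <= Lphi * enorm (v - v')) ->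
  mod_convex 0 (fun v => - F v) ->
  F (v + w) <= F v + dotv (grad F v) w.
Proof.
move=> dF L0 gF Fc.
have gN u : grad (fun v => - F v) u = - grad F u.
  apply/rowP => i; rewrite !mxE -[RHS]deriveN//.
  exact: diff_derivable.
apply: (@ler_small_scale _ _ _ (Lphi / 2 * enorm w ^+ 2)) => t /andP[t0 t1].
have := @smooth_lower_bound (fun v => - F v) Lphi v (t *: w).
rewrite !gN => H; have {}H : _ := H _ L0 _.
have {}H := H (fun v => differentiableN (dF v)).
have {}H : - F v + dotv (- grad F v) (t *: w) - Lphi / 2 * enorm (t *: w) ^+ 2 <=
    - F (v + t *: w).
  apply: H => u u'; rewrite !gN -opprD enormN //.
have t01 : 0 <= t <= 1 by rewrite !ltW.
have := Fc (v + w) v t t01.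
rewrite (_ : t *: (v + w) + _ = v + t *: w); last first.
  by apply/rowP => i; rewrite !mxE; ring.
move: H; rewrite enormZ (gtr0_norm t0) dotvNl dotvZr => H H'.
have : t * F (v + w) <= t * (F v + dotv (grad F v) w + t * (Lphi / 2 * enorm w ^+ 2)).
  by lra.
by rewrite ler_pM2l.
Qed.

End SmoothConcave.

(** * The primal function and its Moreau envelope *)

Section Minimax.
Context {R : realType} {d n : nat}.
Variables (Phi : 'rV[R]_d -> 'rV[R]_n -> R).
Variables (f : 'rV[R]_d -> \bar R) (h : 'rV[R]_n -> \bar R).
Variables (rho L Lf Lphi Dh : R).

(** The two alternatives for f merge into [f_lipschitz]: an indicator is constant on its domain,
    hence Lipschitz there for every nonnegative constant. *)
Record minimax_problem : Prop := MinimaxProblem {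
  rho_gt0 : 0 < rho;
  L_ge0 : 0 <= L;
  Lf_ge0 : 0 <= Lf;
  Lphi_ge0 : 0 <= Lphi;
  Phi_concave : forall u, mod_convex 0 (fun v => - Phi u v);
  Phi_differentiable : forall u v, differentiable (Phi u) v;
  Phi_smooth : forall u v v',
    enorm (grad (Phi u) v - grad (Phi u) v') <= Lphi * enorm (v - v');
  Phi_weakly_convex : forall v, mod_convex (- rho) (Phi ^~ v);
  Phi_lipschitz : forall u u' v, dom h v ->
    `|Phi u v - Phi u' v| <= L * enorm (u - u');
  f_convex : proper_lsc_convex f;
  h_convex : proper_lsc_convex h;
  f_lipschitz : lipschitz_on_dom Lf f;
  dom_h_bounded : forall v v', dom h v -> dom h v' -> enorm (v - v') <= Dh
}.

Hypothesis MP : minimax_problem.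

Let rho0 : 0 < rho. Proof. by case: MP. Qed.
Let L0 : 0 <= L. Proof. by case: MP. Qed.
Let fc : proper_lsc_convex f. Proof. by case: MP. Qed.
Let hc : proper_lsc_convex h. Proof. by case: MP. Qed.

Lemma fine_f_lipschitz x x' : dom f x -> dom f x' ->
  fine (f x) - fine (f x') <= Lf * enorm (x - x').
Proof.
move=> fx fx'; have := f_lipschitz MP fx fx'.
rewrite -(dom_fineK fc fx) -(dom_fineK fc fx') -EFinB /= lee_fin.
exact/le_trans/ler_norm.
Qed.

Lemma continuous_Phi u : continuous (Phi u).
Proof. by move=> v; apply: differentiable_continuous; exact: Phi_differentiable. Qed.

(* The quadratic term makes the maximizer unique and continuous in x, hence
   measurable along the iterates. *)
Definition smoothed_argmax (alpha : R) (y0 : 'rV[R]_n) (x : 'rV[R]_d) : 'rV[R]_n :=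
  minpoint h (fun y => - Phi x y + alpha * enorm (y - y0) ^+ 2).

Section SmoothedArgmax.
Variables (alpha : R) (y0 : 'rV[R]_n).
Hypothesis alpha0 : 0 < alpha.

Local Notation ystar := (smoothed_argmax alpha y0).

Lemma smoothed_argmaxP x : dom h (ystar x) /\ forall y, dom h y ->
  fine (h (ystar x)) - Phi x (ystar x) + alpha * enorm (ystar x - y0) ^+ 2
    + alpha * enorm (y - ystar x) ^+ 2
  <= fine (h y) - Phi x y + alpha * enorm (y - y0) ^+ 2.
Proof.
have cc : continuous (fun y => - Phi x y + alpha * enorm (y - y0) ^+ 2).
  move=> y; apply: (@cvgD R _ _ (nbhs y) _).
    by apply: (@cvgN R _ _ (nbhs y) _); exact: continuous_Phi.
  exact: continuous_sqdist.
have m0 : 0 < 0 + 2 * alpha by rewrite add0r mulr_gt0.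
have [hy H] := minpointP hc cc m0
  (mod_convexD (Phi_concave MP x) (@mod_convex_sqdist _ _ alpha y0)).
have aE : (0 + 2 * alpha) / 2 = alpha by rewrite add0r mulrAC divff// mul1r.
by split => // y /H; rewrite aE !addrA.
Qed.

(** Testing each maximizer in the problem of the other gives alpha |y - y'|^2 <= L |x - x'|. The
    Lipschitz bound in x is applied only at the maximizers, which lie in the domain of h. *)
Lemma continuous_smoothed_argmax : continuous ystar.
Proof.
apply: (@enorm_holder_continuous _ _ _ _ (L / alpha)) => x x'.
have [hy H] := smoothed_argmaxP x; have [hy' H'] := smoothed_argmaxP x'.
have {}H := H _ hy'; have {}H' := H' _ hy.
have := le_trans (ler_norm _) (Phi_lipschitz MP x x' hy).
have := le_trans (ler_norm _) (Phi_lipschitz MP x' x hy').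
rewrite (enormB x' x) mulrAC ler_pdivlMr//.
move: H H'; rewrite (enormB (ystar x')); lra.
Qed.

End SmoothedArgmax.

Definition phi (x : 'rV[R]_d) : R := fine (ereal_sup (range (fun y => (Phi x y)%:E - h y)%E)).

(** The supremum is finite because the maximizer smoothed with alpha = 1 is optimal up to its
    penalty, at most Dh^2 on the bounded domain of h. *)
Lemma phi_supE x : (phi x)%:E = ereal_sup (range (fun y => (Phi x y)%:E - h y)%E).
Proof.
rewrite /phi fineK//.
have [u0 hu0] : dom h !=set0 by have [[]] := hc.
have [hy H] := smoothed_argmaxP u0 ltr01 x.
rewrite fin_numElt; apply/andP; split.
  apply: (@lt_le_trans _ _ ((Phi x u0)%:E - h u0)%E).
    by rewrite -(dom_fineK hc hu0) -EFinB ltNyr.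
  by apply: ereal_sup_ubound; exists u0.
apply: (@le_lt_trans _ _ (- (fine (h (smoothed_argmax 1 u0 x))
   - Phi x (smoothed_argmax 1 u0 x)) + Dh ^+ 2)%:E); last by rewrite ltry.
apply: ge_ereal_sup => _ [y _ <-].
have [hy'|/notin_dom ->] := pselect (dom h y); last by rewrite addeNy leNye.
rewrite -(dom_fineK hc hy') -EFinB lee_fin.
have := H _ hy'; rewrite !mul1r.
have := sqr_ge0 (enorm (smoothed_argmax 1 u0 x - u0)).
have := sqr_ge0 (enorm (y - smoothed_argmax 1 u0 x)).
have : enorm (y - u0) ^+ 2 <= Dh ^+ 2.
  have D := dom_h_bounded MP hy' hu0.
  by rewrite ler_pXn2r// nnegrE ?enorm_ge0// (le_trans _ D)// enorm_ge0.
lra.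
Qed.

Lemma phi_ge x y : dom h y -> Phi x y - fine (h y) <= phi x.
Proof.
move=> hy; rewrite -lee_fin phi_supE EFinB (dom_fineK hc hy).
by apply: ereal_sup_ubound; exists y.
Qed.

Lemma phi_le x a : (forall y, dom h y -> Phi x y - fine (h y) <= a) -> phi x <= a.
Proof.
move=> H; rewrite -lee_fin phi_supE; apply: ge_ereal_sup => _ [y _ <-].
have [hy|/notin_dom ->] := pselect (dom h y); last by rewrite addeNy leNye.
by rewrite -(dom_fineK hc hy) -EFinB lee_fin; exact: H.
Qed.

Lemma smoothed_argmax_near_optimal alpha y0 x : 0 < alpha -> dom h y0 ->
  phi x <= Phi x (smoothed_argmax alpha y0 x) - fine (h (smoothed_argmax alpha y0 x))
    + alpha * Dh ^+ 2.
Proof.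
move=> alpha0 hy0; apply: phi_le => y hy; have [hu /(_ y hy)] := smoothed_argmaxP y0 alpha0 x.
have : alpha * enorm (y - y0) ^+ 2 <= alpha * Dh ^+ 2.
  have D := dom_h_bounded MP hy hy0.
  by rewrite ler_pM2l// ler_pXn2r// nnegrE ?enorm_ge0// (le_trans _ D)// enorm_ge0.
have := mulr_ge0 (ltW alpha0) (sqr_ge0 (enorm (smoothed_argmax alpha y0 x - y0))).
have := mulr_ge0 (ltW alpha0) (sqr_ge0 (enorm (y - smoothed_argmax alpha y0 x))).
lra.
Qed.

Lemma phi_lipschitz x x' : `|phi x - phi x'| <= L * enorm (x - x').
Proof.
have H u u' : phi u <= phi u' + L * enorm (u - u').
  apply: phi_le => y hy; have := phi_ge u' hy.
  by have := le_trans (ler_norm _) (Phi_lipschitz MP u u' hy); lra.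
rewrite ler_norml; have := H x x'; have := H x' x; rewrite (enormB x').
by move=> ? ?; apply/andP; split; lra.
Qed.

Lemma continuous_phi : continuous phi.
Proof. exact: enorm_lipschitz_continuous phi_lipschitz. Qed.

Lemma phi_weakly_convex : mod_convex (- rho) phi.
Proof.
move=> x y t t01; apply: phi_le => v hv.
have := Phi_weakly_convex MP v x y t01.
have [t0 t1] := andP t01.
have : t * (Phi x v - fine (h v)) <= t * phi x by rewrite ler_wpM2l// phi_ge.
have : (1 - t) * (Phi y v - fine (h v)) <= (1 - t) * phi y.
  by rewrite ler_wpM2l ?subr_ge0// phi_ge.
lra.
Qed.

Definition psi (x : 'rV[R]_d) : R := fine (f x) + phi x.

Lemma primalE x : primal Phi f h x = (f x + (phi x)%:E)%E.
Proof. by rewrite /primal -phi_supE. Qed.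

Lemma primal_psiE x : dom f x -> primal Phi f h x = (psi x)%:E.
Proof. by move=> fx; rewrite primalE -(dom_fineK fc fx). Qed.

Definition prox_psi : 'rV[R]_d -> 'rV[R]_d := fun x =>
  minpoint f (fun z => phi z + rho * enorm (z - x) ^+ 2).

Lemma prox_psiP x : dom f (prox_psi x) /\ forall z, dom f z ->
  psi (prox_psi x) + rho * enorm (prox_psi x - x) ^+ 2
    + rho / 2 * enorm (z - prox_psi x) ^+ 2 <= psi z + rho * enorm (z - x) ^+ 2.
Proof.
have cc : continuous (fun z => phi z + rho * enorm (z - x) ^+ 2).
  move=> z; apply: (@cvgD R _ _ (nbhs z) _); first exact: continuous_phi.
  exact: continuous_sqdist.
(* With lambda = 1 / (2 rho) the proximal term is rho |z - x|^2, of modulus 2 rho; it outweighs the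
   weak convexity of phi by rho. *)
have rE : - rho + 2 * rho = rho by ring.
have [] := @minpointP _ _ f _ (- rho + 2 * rho) fc cc _
  (mod_convexD phi_weakly_convex (@mod_convex_sqdist _ _ rho x)).
  by rewrite rE.
by rewrite rE => fp H; split => // z /H; rewrite /psi !addrA.
Qed.

Lemma prox_psi_lipschitz x x' : enorm (prox_psi x - prox_psi x') <= 2 * enorm (x - x').
Proof.
have [fp H] := prox_psiP x; have [fp' H'] := prox_psiP x'.
move: (H _ fp') (H' _ fp); set p := prox_psi x; set p' := prox_psi x'.
clearbody p p'; clear H H' fp fp' => H H'.
have : rho * enorm (p - p') ^+ 2 <= rho * (2 * dotv (p - p') (x - x')).
  move: H H'; rewrite !enorm_sqr !dotv_linE (dotvC p' p) (dotvC x p) (dotvC x p')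
    (dotvC x' p) (dotvC x' p'); lra.
rewrite ler_pM2l// => K.
have [->|pp] := eqVneq (enorm (p - p')) 0; first by rewrite mulr_ge0// enorm_ge0.
have pp0 : 0 < enorm (p - p') by rewrite lt_def pp enorm_ge0.
by rewrite -(ler_pM2l pp0) -expr2 (le_trans K)// mulrCA ler_pM2l// dotv_le.
Qed.

Lemma continuous_prox_psi : continuous prox_psi.
Proof.
move=> x; apply/(@cvgrPdist_lt _ _ _ (nbhs x)) => a a0.
have a20 : 0 < a / 2 by rewrite divr_gt0.
have := near_enorm_lt x a20; apply: filterS => y yx.
have : enorm (prox_psi x - prox_psi y) < a.
  by rewrite (le_lt_trans (prox_psi_lipschitz _ _))// enormB; lra.
exact: le_lt_trans (normr_le_enorm _).
Qed.

Definition env (x : 'rV[R]_d) : R :=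
  psi (prox_psi x) + rho * enorm (prox_psi x - x) ^+ 2.

Lemma env_le x z : dom f z -> env x <= psi z + rho * enorm (z - x) ^+ 2.
Proof.
move=> fz; have [_ /(_ z fz)] := prox_psiP x; apply: le_trans.
by rewrite lerDl mulr_ge0 ?sqr_ge0// divr_ge0// ltW.
Qed.

Lemma env_psi_le x : dom f x ->
  env x + rho / 2 * enorm (prox_psi x - x) ^+ 2 <= psi x.
Proof.
move=> fx; have [_ /(_ x fx)] := prox_psiP x.
by rewrite subrr enorm0 expr0n mulr0 addr0 (enormB x).
Qed.

Lemma moreauE x : moreau (1 / (2 * rho)) (primal Phi f h) x = (env x)%:E.
Proof.
have rE : (2 * (1 / (2 * rho)))^-1 = rho by field; rewrite gt_eqF.
rewrite /moreau rE; apply/eqP; rewrite eq_le; apply/andP; split.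
  apply: ereal_inf_lbound; exists (prox_psi x) => //.
  by rewrite primal_psiE -?EFinD//; have [] := prox_psiP x.
apply: le_ereal_inf_tmp => _ [z _ <-].
have [fz|/notin_dom fz] := pselect (dom f z); last by rewrite primalE fz !addye// leey.
by rewrite primal_psiE// -EFinD lee_fin env_le.
Qed.

(** Evaluating the envelope at x with the proximal point of x + v, and conversely, traps the
    increment between two quadratics. They differ by O(|v|^2) because the proximal map is
    Lipschitz. *)
Lemma env_expansion x v :
  `|env (x + v) - env x - 2 * rho * dotv (x - prox_psi x) v| <= 3 * rho * enorm v ^+ 2.
Proof.
have [fp _] := prox_psiP x; have [fp' _] := prox_psiP (x + v).
have := env_le (x + v) fp; have := env_le x fp'.
have := prox_psi_lipschitz (x + v) x; rewrite (addrC x v) addrK.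
have := dotv_le (prox_psi (v + x) - prox_psi x) v.
rewrite /env; set p := prox_psi x; set p' := prox_psi (v + x).
clearbody p p'; clear fp fp'; move=> H1 /(ler_wpM2r (enorm_ge0 v)) H2 H3 H4.
have H5 : rho * dotv (p' - p) v <= rho * (2 * enorm v * enorm v).
  by rewrite ler_pM2l//; exact: le_trans H2.
have r0 : 0 <= rho * enorm v ^+ 2 by rewrite mulr_ge0 ?sqr_ge0// ltW.
have E1 : enorm (p - (v + x)) ^+ 2 =
    enorm (p - x) ^+ 2 + 2 * dotv (x - p) v + enorm v ^+ 2.
  by rewrite !enorm_sqr !dotv_linE (dotvC x p) (dotvC v p) (dotvC v x); ring.
have E2 : enorm (p' - x) ^+ 2 = enorm (p' - (v + x)) ^+ 2
    - 2 * dotv (x - p) v + 2 * dotv (p' - p) v - enorm v ^+ 2.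
  rewrite !enorm_sqr !dotv_linE (dotvC x p') (dotvC v p') (dotvC v x); ring.
move: H3 H4; rewrite E1 E2 => H3 H4.
by rewrite ler_norml; apply/andP; split; lra.
Qed.

Lemma grad_moreauE x :
  grad_moreau (1 / (2 * rho)) (primal Phi f h) x = (2 * rho) *: (x - prox_psi x).
Proof.
have -> : grad_moreau (1 / (2 * rho)) (primal Phi f h) x = grad env x.
  by rewrite /grad_moreau; congr grad; apply/funext => z; rewrite moreauE.
apply/rowP => i; rewrite !mxE; set v := delta_mx 0 i.
set l : R := _ * (_ + _).
have vE : dotv (x - prox_psi x) v = x 0 i - prox_psi x 0 i.
  rewrite /dotv (bigD1 i)//= big1 ?addr0 => [|j ji]; rewrite !mxE ?eqxx ?mulr1//.
  by rewrite (negbTE ji) andbF mulr0.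
have vv : enorm v ^+ 2 = 1.
  rewrite enorm_sqr /dotv (bigD1 i)//= big1 ?addr0 => [|j ji]; rewrite !mxE ?eqxx ?mulr1//.
  by rewrite (negbTE ji) andbF mulr0.
apply/cvg_lim => //; apply/cvgrPdist_le => a a0.
near=> t.
have t0 : t != 0 by near: t; exact: nbhs_dnbhs_neq.
have := env_expansion x (t *: v).
rewrite dotvZr vE enormZ exprMn vv mulr1 real_normK ?num_real// => H.
rewrite /= -normrN opprB (addrC _ x).
have -> : t^-1 *: (env (x + t *: v) - env x) - l =
    t^-1 * (env (x + t *: v) - env x - 2 * rho * (t * (x 0 i - prox_psi x 0 i))).
  by rewrite /l /GRing.scale/=; field.
rewrite normrM (le_trans (ler_wpM2l _ H))// normfV.
have -> : `|t|^-1 * (3 * rho * t ^+ 2) = 3 * rho * `|t|.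
  by rewrite -(@real_normK _ t) ?num_real//; field; rewrite normr_eq0.
rewrite mulrC -ler_pdivlMr ?mulr_gt0//.
near: t; apply: dnbhs0_le; rewrite divr_gt0// mulr_gt0//.
Unshelve. all: by end_near. Qed.

End Minimax.

(** * One step of the method *)

Section OneStep.
Context {R : realType} {d n : nat}.
Variables (Phi : 'rV[R]_d -> 'rV[R]_n -> R).
Variables (f : 'rV[R]_d -> \bar R) (h : 'rV[R]_n -> \bar R).
Variables (rho L Lf Lphi Dh : R).
Hypothesis MP : minimax_problem Phi f h rho L Lf Lphi Dh.

Let rho0 : 0 < rho. Proof. by case: MP. Qed.
Let L0 : 0 <= L. Proof. by case: MP. Qed.
Let fc : proper_lsc_convex f. Proof. by case: MP. Qed.
Let hc : proper_lsc_convex h. Proof. by case: MP. Qed.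

Local Notation phi := (phi Phi h).
Local Notation psi := (psi Phi f h).
Local Notation prox_psi := (prox_psi Phi f h rho).
Local Notation env := (env Phi f h rho).

Section MinimizationStep.
Variables (eta : R) (x g gbar : 'rV[R]_d).
Hypotheses (eta0 : 0 < eta) (gbarL : enorm gbar <= L).

Local Notation p := (prox eta f (x - eta *: g)).

Let etaV : (2 * eta)^-1 = eta^-1 / 2.
Proof. by rewrite invfM mulrC. Qed.

Let fp : dom f p. Proof. by have [] := proxP fc eta0 (x - eta *: g). Qed.

Let g_le : enorm g <= L + enorm (g - gbar).
Proof.
by rewrite -[leLHS](congr1 enorm (subrK gbar g)) addrC (le_trans (ler_enormD _ _))// lerD2r.
Qed.

Let decrease : dom f x ->
  fine (f p) + dotv g (p - x) <= fine (f x) - eta^-1 * enorm (p - x) ^+ 2.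
Proof.
move=> fx; have := prox_step fc eta0 x g fx; rewrite subrr enorm0 expr0n sub0r enormB etaV; lra.
Qed.

Lemma prox_step_norm : dom f x -> enorm (p - x) <= eta * (Lf + enorm g).
Proof.
move=> fx; have := decrease fx; have := fine_f_lipschitz MP fx fp.
have := dotv_le (- g) (p - x); rewrite dotvNl enormN (enormB x).
set a := enorm (p - x) => H1 H2 H3.
have {}H3 : eta^-1 * a ^+ 2 <= (Lf + enorm g) * a by lra.
have [->|a0] := eqVneq a 0.
  by rewrite mulr_ge0 ?(ltW eta0)// addr_ge0 ?enorm_ge0//; case: MP.
have ap : 0 < a by rewrite lt_def a0 enorm_ge0.
by move: H3; rewrite expr2 mulrA ler_pM2r// mulrC ler_pdivrMr// mulrC.
Qed.

(** The right side bounds the size of a subgradient-like vector at p. Testing the step at z(p)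
    bounds psi(p) - psi(z(p)) by this size times |z(p) - p|, while the growth at z(p) bounds it
    below by 3/2 rho |z(p) - p|^2. *)
Lemma prox_psi_dist_le :
  3 / 2 * rho * enorm (prox_psi p - p) <= L + enorm g + eta^-1 * enorm (p - x).
Proof.
have fz : dom f (prox_psi p) by have [] := prox_psiP MP p.
have := prox_step fc eta0 x g fz.
have := env_psi_le MP fp; rewrite /env /psi.
have := le_trans (ler_norm _) (phi_lipschitz MP p (prox_psi p)).
have := dotv_le g (prox_psi p - p); have := dotv_le (prox_psi p - p) (p - x).
have E : enorm (prox_psi p - x) ^+ 2 - enorm (prox_psi p - p) ^+ 2 - enorm (p - x) ^+ 2
  = 2 * dotv (prox_psi p - p) (p - x).
  exact: enorm_three_points.
rewrite E (enormB p (prox_psi p)) etaV -(opprB p) dotvNr.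
rewrite (opprB p); set r := enorm (prox_psi p - p).
set a := enorm (p - x); set q := dotv (_ - _) (_ - _).
move=> H1 H2 H3 H4 H5.
have : eta^-1 * q <= eta^-1 * (r * a) by rewrite ler_pM2l// invr_gt0.
move=> H6.
have {H4}H7 : 3 / 2 * rho * r * r <= (L + enorm g + eta^-1 * a) * r by lra.
have [->|r0] := eqVneq r 0.
  rewrite mulr0 addr_ge0// ?addr_ge0 ?enorm_ge0//.
  by rewrite mulr_ge0 ?enorm_ge0// invr_ge0 ltW.
by move: H7; rewrite ler_pM2r// lt_def r0 enorm_ge0.
Qed.

(* No smallness of eta is needed here, unlike in env_step: this covers the
   large steps, for which eta * rho is not small. *)
Lemma psi_step : dom f x ->
  psi p + eta * (rho ^+ 2 * enorm (prox_psi p - p) ^+ 2) / 4 <=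
    psi x + 5 * eta * (L ^+ 2 + enorm (g - gbar) ^+ 2).
Proof.
move=> fx; have := decrease fx; have := prox_psi_dist_le.
have := le_trans (ler_norm _) (phi_lipschitz MP p x).
have := dotv_le (- g) (p - x); rewrite dotvNl enormN /psi.
have := g_le; have := enorm_ge0 g; have := enorm_ge0 (g - gbar).
have := enorm_ge0 (prox_psi p - p).
have := enorm_ge0 (p - x).
set G := enorm g; set nn := enorm (g - gbar); set r := enorm (prox_psi p - p).
(* In units of eta for the displacement, every term is proportional to eta and the remaining
   inequality [key] is free of it. *)
have [a ->] : exists a, enorm (p - x) = eta * a.
  by exists (eta^-1 * enorm (p - x)); rewrite mulrA divff ?mul1r// gt_eqF.
have -> : eta^-1 * (eta * a) ^+ 2 = eta * a ^+ 2.
  by field; rewrite gt_eqF.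
have -> : eta^-1 * (eta * a) = a by field; rewrite gt_eqF.
rewrite pmulr_rge0// => a0 r0 n0 G0 GL H1 H2 H3 H4.
have rr : (rho * r) ^+ 2 <= (2 / 3 * (L + G + a)) ^+ 2.
  have rr0 : 0 <= rho * r by rewrite mulr_ge0// ltW.
  by rewrite ler_pXn2r// ?nnegrE//; lra.
have L0' := L0.
have key : (L + G) * a - a ^+ 2 + (rho * r) ^+ 2 / 4 <= 5 * (L ^+ 2 + nn ^+ 2).
  have ss : (L + G) ^+ 2 <= (2 * L + nn) ^+ 2 by rewrite ler_pXn2r// ?nnegrE; lra.
  (* With the bound on rho r inserted, the left side is a concave quadratic in a with vertex 11/16
     (L + G). The next square handles the cross term of (2 L + nn)^2. *)
  have := sqr_ge0 ((L + G) * 11 / 16 - a).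
  have := sqr_ge0 (L - 2 * nn).
  have := sqr_ge0 L; have := sqr_ge0 nn; have := sqr_ge0 (L + G).
  nra.
have := ler_wpM2l (ltW eta0) key.
lra.
Qed.

(* Gam bounds the error made by replacing phi by Phi(., y) in the subgradient
   inequality: the duality gap at (x, y), or a multiple of L^2 / rho. *)
Lemma env_step Gam : 4 * (eta * rho) <= 1 ->
  dotv gbar (prox_psi x - x) <= phi (prox_psi x) - phi x + Gam
    + rho / 2 * enorm (prox_psi x - x) ^+ 2 ->
  env p + eta * (rho ^+ 2 * enorm (prox_psi x - x) ^+ 2) <= env x
    + 2 * (rho * eta) * Gam + 16 * rho * eta ^+ 2 * (L ^+ 2 + enorm (g - gbar) ^+ 2)
    + 2 * (rho * eta) * dotv (g - gbar) (prox_psi x - x).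
Proof.
move=> etarho HGam.
have [fz zmin] := prox_psiP MP x.
have H1 := prox_step fc eta0 x g fz.
have H2 := env_le MP p fz.
have H3 := zmin p fp.
have H4 := le_trans (ler_norm _) (phi_lipschitz MP p x).
have H5 := dotv_le (- g) (p - x).
have H6 := g_le.
have D0 := enorm_ge0 (p - x).
have n0 := enorm_ge0 (g - gbar).
have g0 := enorm_ge0 g.
have L0' := L0.
clear zmin.
have -> : env x = psi (prox_psi x) + rho * enorm (prox_psi x - x) ^+ 2 by [].
move: H1 H2 H3 H4 H5 H6 HGam D0 n0 g0; rewrite /psi etaV.
have -> : dotv (- g) (p - x) = dotv g (p - prox_psi x) - dotv g (p - prox_psi x)
   - dotv g (p - x) by rewrite dotvNl subrr sub0r.
have -> : dotv g (p - x) = dotv g (p - prox_psi x)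
   + dotv gbar (prox_psi x - x) + dotv (g - gbar) (prox_psi x - x).
  by rewrite !dotv_linE; ring.
rewrite enormN (enormB p (prox_psi x)).
move: (dotv gbar _) (dotv (g - gbar) _) (dotv g _) => q1 q2 q3.
move: (enorm (prox_psi x - x)) (enorm (prox_psi x - p)) (enorm (p - x)) => r rp D.
move: (enorm g) (enorm (g - gbar)) => G nn.
move: (fine (f p)) (fine (f (prox_psi x))) (phi p) (phi x) (phi (prox_psi x)) => fp' fz' pp px pz.
move=> H1 H2 H3 H4 H5 H6 H7 D0 n0 G0.
have H8 : rp ^+ 2 <= r ^+ 2 - D ^+ 2 + 2 * eta * (fz' - fp' - q3).
  have := H1; rewrite -(ler_pM2l eta0) => H.
  have e1 : eta * eta^-1 = 1 by rewrite divff// gt_eqF.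
  have : eta * (eta^-1 / 2 * (r ^+ 2 - rp ^+ 2 - D ^+ 2)) =
    (r ^+ 2 - rp ^+ 2 - D ^+ 2) / 2 by rewrite !mulrA e1 mul1r; ring.
  lra.
(* Growth at the proximal point yields - rho r^2 and the subgradient inequality costs rho / 2 r^2;
   what remains is the descent term. *)
have H9 : fz' - fp' - q3 <= (L + G) * D + Gam + rho * D ^+ 2 - rho / 2 * r ^+ 2 + q2.
  have : 0 <= rho / 2 * rp ^+ 2 by rewrite mulr_ge0 ?sqr_ge0// divr_ge0// ltW.
  lra.
have H10 := ler_wpM2l (ltW eta0) H9.
(* The term - D^2 of the proximal step is spent in two halves: one on the curvature term, which is
   where 4 eta rho <= 1 enters, the other on (L + G) D through Young's inequality. *)
have H11 : eta * rho * D ^+ 2 <= D ^+ 2 / 4 by rewrite mulrC ler_wpM2l ?sqr_ge0//; lra.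
have H12 : 2 * (eta * ((L + G) * D)) <= D ^+ 2 / 2 + 2 * eta ^+ 2 * (L + G) ^+ 2.
  by have := sqr_ge0 (D - 2 * eta * (L + G)); lra.
have H13 : (L + G) ^+ 2 <= 8 * (L ^+ 2 + nn ^+ 2).
  have : (L + G) ^+ 2 <= (2 * L + nn) ^+ 2 by rewrite ler_pXn2r// ?nnegrE; lra.
  have := sqr_ge0 (L - nn); have := sqr_ge0 L; have := sqr_ge0 nn; nra.
have H14 : eta ^+ 2 * (L + G) ^+ 2 <= eta ^+ 2 * (8 * (L ^+ 2 + nn ^+ 2)).
  by rewrite ler_wpM2l// sqr_ge0.
have : rho * rp ^+ 2 <= rho * (r ^+ 2 + 2 * (eta * Gam) - eta * rho * r ^+ 2
   + 2 * (eta * q2) + 16 * eta ^+ 2 * (L ^+ 2 + nn ^+ 2)).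
  by rewrite ler_pM2l//; lra.
lra.
Qed.

End MinimizationStep.

(** * The gap of the inner maximization and one ascent step *)

Definition gap x y := phi x - (Phi x y - fine (h y)).

Lemma gap_ge0 x y : dom h y -> 0 <= gap x y.
Proof. by move=> hy; rewrite subr_ge0 (phi_ge MP). Qed.

Lemma smoothed_argmax_gap alpha y0 x x' : 0 < alpha -> dom h y0 ->
  gap x' (smoothed_argmax Phi h alpha y0 x) <= alpha * Dh ^+ 2 + 2 * L * enorm (x' - x).
Proof.
move=> a0 hy0; have := smoothed_argmax_near_optimal MP x a0 hy0.
have [hu _] := smoothed_argmaxP MP y0 a0 x.
have := le_trans (ler_norm _) (Phi_lipschitz MP x x' hu).
have := le_trans (ler_norm _) (phi_lipschitz MP x' x).
by rewrite /gap (enormB x); lra.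
Qed.

(** The noise is paired with y - u, which does not involve the current sample, so that this term
    averages out; the part paired with y' - y is absorbed. *)
Lemma ascent_step gam x y u G : 0 < gam -> 2 * gam * Lphi <= 1 -> dom h u ->
  let y' := prox gam h (y + gam *: G) in
  gap x y' + (2 * gam)^-1 * enorm (u - y') ^+ 2 <=
    gap x u + (2 * gam)^-1 * enorm (u - y) ^+ 2
    + gam * enorm (G - grad (Phi x) y) ^+ 2 + dotv (G - grad (Phi x) y) (y - u).
Proof.
move=> gam0 gamL hu /=; set y' := prox gam h _.
have y'E : y' = prox gam h (y - gam *: - G) by rewrite scalerN opprK.
have H1 := prox_step hc gam0 y (- G) hu.
rewrite -y'E in H1.
have H2 := smooth_lower_bound y (y' - y) (Phi_differentiable MP x) (Lphi_ge0 MP)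
  (Phi_smooth MP x).
have H3 := concave_upper_bound y (u - y) (Phi_differentiable MP x) (Lphi_ge0 MP)
  (Phi_smooth MP x) (Phi_concave MP x).
rewrite !(addrC y) !subrK in H2 H3.
have H4 := dotv_le (G - grad (Phi x) y) (y' - y).
rewrite /gap.
have E : dotv (- G) (y' - u) = - (dotv (grad (Phi x) y) (y' - y)
  + dotv (G - grad (Phi x) y) (y' - y) + dotv (G - grad (Phi x) y) (y - u)
  - dotv (grad (Phi x) y) (u - y)).
  by rewrite !dotv_linE; ring.
rewrite E in H1; move: H1 H2 H3 H4; clear y'E E; clearbody y'.
have -> : (2 * gam)^-1 = gam^-1 / 2 by rewrite invfM mulrC.
set q1 := dotv _ (y' - y); set q2 := dotv (G - _) (y' - y).
set q3 := dotv _ (u - y); set q4 := dotv _ (y - u).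
set D := enorm (y' - y); set nn := enorm (G - _) => H1 H2 H3 H4.
(* The factor 2 in [2 * gam * Lphi <= 1] makes the smoothness error consume only half of the
   available D^2 / (2 gam); the noise takes the other half in [H6]. *)
have H5 : Lphi / 2 * D ^+ 2 <= gam^-1 / 4 * D ^+ 2.
  rewrite ler_wpM2r ?sqr_ge0//.
  have : Lphi <= gam^-1 / 2 by rewrite ler_pdivlMr// -[leRHS]mul1r ler_pdivlMr//; lra.
  lra.
have H6 : nn * D <= gam * nn ^+ 2 + gam^-1 / 4 * D ^+ 2.
  have : 0 <= gam * (nn - gam^-1 / 2 * D) ^+ 2 by rewrite mulr_ge0 ?sqr_ge0 ?ltW.
  have -> : gam * (nn - gam^-1 / 2 * D) ^+ 2 =
    gam * nn ^+ 2 - nn * D + gam^-1 / 4 * D ^+ 2 by field; rewrite gt_eqF.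
  lra.
lra.
Qed.

End OneStep.

(** * Borel measurability of vector-valued maps *)

Definition ratv {R : realType} n (q : 'rV[rat]_n) : 'rV[R]_n := map_mx ratr q.

Lemma rat_vec_dense {R : realType} n (u : 'rV[R]_n) (a : R) : 0 < a ->
  exists q, ball u a (ratv q).
Proof.
move=> a0.
have H i : exists q : rat, ratr q \in `]u 0 i - a, u 0 i + a[.
  by apply: rat_in_itvoo; lra.
exists (\row_i sval (cid (H i))); split => // i j; rewrite (ord1 i) !mxE.
case: cid => q /=; rewrite in_itv/= => /andP[q1 q2].
by rewrite /ball/= /ball_/= ltr_distlC; apply/andP; split; lra.
Qed.

Section BorelVectors.
Context {R : realType} {dT : measure_display} {T : measurableType dT}.

(** An open set is the countable union of the balls it contains with rational centre and radius 1 /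
    (k + 1), and a ball of the sup norm is a finite intersection of coordinate conditions. *)
Lemma measurable_fun_coords n (v : T -> 'rV[R]_n) :
  (forall i, measurable_fun setT (fun t => v t 0 i)) ->
  measurable_fun setT (v : T -> @borelV R n).
Proof.
move=> vm; apply: (@measurability _ _ T (@borelV R n) setT v open) => // _ [U oU <-].
rewrite setTI.
pose W (p : 'rV[rat]_n * nat) : set T :=
  if `[< ball (ratv p.1 : 'rV[R]_n) (p.2.+1%:R^-1 : R) `<=` U >]
  then v @^-1` ball (ratv p.1) (p.2.+1%:R^-1 : R) else set0.
have -> : v @^-1` U = \bigcup_p W p.
  apply/seteqP; split => [t Ut|t [p _]]; last first.
    by rewrite /W; case: asboolP => // H /H.
  have /nbhs_ballP[a /= a0 aU] : nbhs (v t) U.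
    by apply: open_nbhs_nbhs; split.
  have a20 : 0 < a / 2 by rewrite divr_gt0.
  have [k _ /(_ k (leqnn k)) /= ka] := near_infty_natSinv_lt (PosNum a20).
  have k0 : 0 < (k.+1%:R^-1 : R) by rewrite invr_gt0.
  have [q qb] := rat_vec_dense (v t) k0.
  exists (q, k) => //; rewrite /W; case: asboolP => [_|/= H]; first exact: ball_sym.
  exfalso; apply: H => y qy; apply: aU.
  by apply: (@ball_split _ _ (ratv q)); apply: le_ball (ltW ka) _ _.
apply: countable_bigcupT_measurable => // p; rewrite /W; case: asboolP => // _.
set r : R := _%:R^-1.
have r0 : 0 < r by rewrite invr_gt0.
have -> : v @^-1` ball (ratv p.1) r =
    \bigcap_(i in [set: 'I_n]) ((fun t => v t 0 i) @^-1` ball (ratr (p.1 0 i) : R) r).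
  apply/seteqP; split => [t [_ H] i _|t H] /=; first by have := H 0 i; rewrite mxE.
  by split => // i j; rewrite (ord1 i) mxE; exact: H.
apply: fin_bigcap_measurable => // i _.
rewrite -[X in measurable X]setTI; apply: vm => //.
by apply: open_measurable; exact: ball_open.
Qed.

Lemma measurable_borel_cst n (v : 'rV[R]_n) :
  measurable_fun setT ((fun=> v) : T -> @borelV R n).
Proof. exact: measurable_cst. Qed.

Lemma measurable_fun_continuous_comp n m (v : T -> 'rV[R]_n)
    (c : 'rV[R]_n -> 'rV[R]_m) :
  continuous c -> measurable_fun setT (v : T -> @borelV R n) ->
  measurable_fun setT (c \o v : T -> @borelV R m).
Proof.
move=> cc vm; apply: (@measurability _ _ T (@borelV R m) setT (c \o v) open) => // _ [U oU <-].
rewrite setTI comp_preimage -[X in measurable X]setTI; apply: vm => //.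
by apply: sub_sigma_algebra; exact: open_comp.
Qed.

Lemma measurable_fun_real_continuous_comp n (v : T -> 'rV[R]_n) (c : 'rV[R]_n -> R) :
  continuous c -> measurable_fun setT (v : T -> @borelV R n) ->
  measurable_fun setT (c \o v).
Proof.
move=> cc vm; apply: (measurability _ (RGenInftyO.measurableE R)) => _ [_ [a ->] <-].
rewrite setTI comp_preimage -[X in measurable X]setTI; apply: vm => //.
apply: sub_sigma_algebra; apply: open_comp => //.
Qed.

Lemma measurable_fun_coord n (v : T -> 'rV[R]_n) i :
  measurable_fun setT (v : T -> @borelV R n) -> measurable_fun setT (fun t => v t 0 i).
Proof.
exact: (measurable_fun_real_continuous_comp (@coord_continuous R 1 n 0 i)).
Qed.

(** Strict superlevel sets of a lower semicontinuous function are open. The value 0 given by [fine]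
    at infinity is harmless, as the iterates stay in the domains of f and h. *)
Lemma measurable_fun_lsc_comp n (v : T -> 'rV[R]_n) (e : 'rV[R]_n -> \bar R) :
  lower_semicontinuous e -> measurable_fun setT (v : T -> @borelV R n) ->
  measurable_fun setT (fine \o e \o v).
Proof.
move=> elsc vm; apply: (@measurableT_comp _ _ _ _ _ _ fine) => //.
apply: (measurability _ (ErealGenOInfty.measurableE R)) => _ [_ [a ->] <-].
rewrite setTI comp_preimage -[X in measurable X]setTI; apply: vm => //.
apply: sub_sigma_algebra.
by rewrite preimage_itvoy; move/lower_semicontinuousP : elsc; exact.
Qed.

Lemma measurable_fun_dotv n (u v : T -> 'rV[R]_n) :
  measurable_fun setT (u : T -> @borelV R n) ->
  measurable_fun setT (v : T -> @borelV R n) ->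
  measurable_fun setT (fun t => dotv (u t) (v t)).
Proof.
move=> um vm; apply: measurable_sum => i.
by apply: measurable_funM; exact: measurable_fun_coord.
Qed.

Lemma measurable_fun_lincomb n (u v : T -> 'rV[R]_n) (a : R) :
  measurable_fun setT (u : T -> @borelV R n) ->
  measurable_fun setT (v : T -> @borelV R n) ->
  measurable_fun setT (fun t => u t + a *: v t : @borelV R n).
Proof.
move=> um vm; apply: measurable_fun_coords => i.
under eq_fun do rewrite !mxE.
apply: measurable_funD; first exact: measurable_fun_coord.
by apply: measurable_funM => //; exact: measurable_fun_coord.
Qed.

Lemma measurable_fun_enorm n (u : T -> 'rV[R]_n) :
  measurable_fun setT (u : T -> @borelV R n) ->
  measurable_fun setT (fun t => enorm (u t)).
Proof. exact: (measurable_fun_real_continuous_comp (@continuous_enorm R n)). Qed.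

Lemma measurable_fun_enormB n (u v : T -> 'rV[R]_n) :
  measurable_fun setT (u : T -> @borelV R n) ->
  measurable_fun setT (v : T -> @borelV R n) ->
  measurable_fun setT (fun t => enorm (u t - v t)).
Proof.
move=> um vm; apply: measurable_fun_enorm.
by under eq_fun do rewrite -scaleN1r; exact: measurable_fun_lincomb.
Qed.

Lemma measurable_fun_joint d n m dX (Xi : measurableType dX)
    (F : 'rV[R]_d -> 'rV[R]_n -> Xi -> 'rV[R]_m)
    (u : T -> 'rV[R]_d) (v : T -> 'rV[R]_n) (s : T -> Xi) :
  joint_measurable F -> measurable_fun setT (u : T -> @borelV R d) ->
  measurable_fun setT (v : T -> @borelV R n) -> measurable_fun setT s ->
  measurable_fun setT (fun t => F (u t) (v t) (s t) : @borelV R m).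
Proof.
move=> Fm um vm sm; apply: measurable_fun_coords => i.
apply: (@measurableT_comp _ _ _ _ _ _
  (fun p : borelV d * borelV n * Xi => F p.1.1 p.1.2 p.2 0 i)
  _ (fun t => (u t, v t, s t))); first exact: Fm.
by apply: measurable_fun_pair => //; exact: measurable_fun_pair.
Qed.

(* On the range of v, Phi(x, v) is the infimum of Phi(q, v) + L |x - q| over the
   rational q, whose terms are measurable. *)
Lemma measurable_fun_lipschitz_continuous d n (Phi : 'rV[R]_d -> 'rV[R]_n -> R) L
    (D : set 'rV[R]_n) (u : T -> 'rV[R]_d) (v : T -> 'rV[R]_n) :
  0 <= L -> (forall x, continuous (Phi x)) ->
  (forall x x' y, D y -> `|Phi x y - Phi x' y| <= L * enorm (x - x')) ->
  measurable_fun setT (u : T -> @borelV R d) ->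
  measurable_fun setT (v : T -> @borelV R n) -> (forall t, D (v t)) ->
  measurable_fun setT (fun t => Phi (u t) (v t)).
Proof.
move=> L0 Phic PhiL um vm vD.
apply: (measurability _ (RGenInftyO.measurableE R)) => _ [_ [a ->] <-].
rewrite setTI; pose F (q : 'rV[rat]_d) t :=
  Phi (ratv q) (v t) + L * enorm (u t - ratv q).
have -> : (fun t => Phi (u t) (v t)) @^-1` `]-oo, a[%classic =
    \bigcup_q F q @^-1` `]-oo, a[%classic.
  apply/seteqP; split => [t|t [q _]] /=; rewrite !in_itv/=; last first.
    apply: le_lt_trans.
    by have := le_trans (ler_norm _) (PhiL (u t) (ratv q) _ (vD t)); rewrite /F; lra.
  move=> ta; pose b := (a - Phi (u t) (v t)) / (2 * (L + 1)).
  have b0 : 0 < b by rewrite divr_gt0; lra.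
  have /nbhs_ballP[c /= c0 cb] := near_enorm_lt (u t) b0.
  have [q /cb /= qb] := rat_vec_dense (u t) c0.
  exists q => //=; rewrite in_itv/= /F.
  have := le_trans (ler_norm _) (PhiL (ratv q) (u t) _ (vD t)).
  rewrite (enormB (u t)); set e := enorm _ in qb *.
  have : L * e <= L * b by rewrite ler_wpM2l// ltW.
  have : 2 * (L + 1) * b = a - Phi (u t) (v t).
    by rewrite /b mulrC divfK// gt_eqF//; lra.
  lra.
apply: countable_bigcupT_measurable => // q.
rewrite -[X in measurable X]setTI.
suff : measurable_fun setT (F q) by apply.
apply: measurable_funD.
  exact: (measurable_fun_real_continuous_comp (Phic (ratv q))).
apply: measurable_funM => //; apply: measurable_fun_enormB => //.
Qed.

End BorelVectors.

Lemma integral_prob_cst {R : realType} {dT} {T : measurableType dT}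
  (P : probability T R) (c : R) : (\int[P]_w c%:E = c%:E)%E.
Proof.
transitivity (c%:E * P [set: T])%E; first exact: integral_cst.
by rewrite probability_setT mule1.
Qed.

(** * Averaging over one sample and conditioning on the past *)

Section NoiseIntegrals.
Context {R : realType} {dX : measure_display} {Xi : measurableType dX}.
Variables (D : probability Xi R) (m : nat) (v : Xi -> 'rV[R]_m) (sigma : R).
Hypotheses (vI : integrable_vec D v)
  (vS : (mean_sqdist D v (mean_vec D v) <= (sigma ^+ 2)%:E)%E).

Local Notation noise := (fun s => v s - mean_vec D v).

Lemma noise_coord_integrable i : D.-integrable setT (fun s => (noise s 0 i)%:E).
Proof.
under eq_fun do rewrite !mxE EFinB.
apply: integrableB => //; exact: finite_measure_integrable_cst.
Qed.

Lemma noise_coord_mean i : (\int[D]_s (noise s 0 i)%:E = 0)%E.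
Proof.
under eq_integral do rewrite !mxE EFinB.
rewrite integralB//; last exact: finite_measure_integrable_cst.
rewrite integral_prob_cst unlock.
rewrite fineK ?subee//; first exact: integrable_fin_num.
exact: integrable_fin_num.
Qed.

Lemma noise_measurable : measurable_fun setT (noise : Xi -> @borelV R m).
Proof.
apply: measurable_fun_coords => i; apply/measurable_EFinP.
by have /integrableP[] := noise_coord_integrable i.
Qed.

(** Every one-step inequality is averaged in this form, with a, c0 and c1 fixed by the past.
    Integrability is established for the right side alone; F is merely nonnegative and
    measurable. *)
Lemma noise_bound (a : 'rV[R]_m) (c0 c1 : R) (F : Xi -> R) :
  0 <= c1 -> measurable_fun setT F -> (forall s, 0 <= F s) ->
  (forall s, F s <= c0 + c1 * enorm (noise s) ^+ 2 + dotv (noise s) a) ->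
  (\int[D]_s (F s)%:E <= (c0 + c1 * sigma ^+ 2)%:E)%E.
Proof.
move=> c10 Fm F0 FB.
have nm := measurable_fun_enorm noise_measurable.
have n2m : measurable_fun setT (fun s => enorm (noise s) ^+ 2) by exact: measurable_funX.
have n2 : (\int[D]_s (enorm (noise s) ^+ 2)%:E <= (sigma ^+ 2)%:E)%E.
  by move: vS; rewrite /mean_sqdist unlock.
have i2 : D.-integrable setT (fun s => (enorm (noise s) ^+ 2)%:E).
  apply/integrableP; split; first exact/measurable_EFinP.
  under eq_integral do rewrite gee0_abs ?lee_fin ?sqr_ge0//.
  by rewrite (le_lt_trans n2)// ltry.
have i1 i : D.-integrable setT (fun s => (noise s 0 i * a 0 i)%:E).
  under eq_fun do rewrite mulrC EFinM.
  by apply: integrableZl => //; exact: noise_coord_integrable.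
have idot : D.-integrable setT (fun s => (dotv (noise s) a)%:E).
  by under eq_fun do rewrite /dotv -sumEFin; exact: integrable_sum.
have edot : (\int[D]_s (dotv (noise s) a)%:E = 0)%E.
  under eq_integral do rewrite /dotv -sumEFin.
  rewrite integral_sum// big1// => i _.
  under eq_integral do rewrite mulrC EFinM.
  by rewrite integralZl ?noise_coord_mean ?mule0//; exact: noise_coord_integrable.
have ic : D.-integrable setT (fun=> c0%:E) by exact: finite_measure_integrable_cst.
have iZ : D.-integrable setT (fun s => (c1%:E * (enorm (noise s) ^+ 2)%:E)%E).
  exact: integrableZl.
apply: (@le_trans _ _
  (\int[D]_s (c0%:E + c1%:E * (enorm (noise s) ^+ 2)%:E + (dotv (noise s) a)%:E))%E).
  apply: ge0_le_integral => //.
  - by move=> s _; rewrite lee_fin.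
  - exact/measurable_EFinP.
  - under eq_fun do rewrite -EFinM -!EFinD; apply/measurable_EFinP.
    apply: measurable_funD; last exact: measurable_fun_dotv noise_measurable _.
    by apply: measurable_funD => //; exact: measurable_funM.
  - by move=> s _; rewrite -EFinM -!EFinD lee_fin.
rewrite integralD//; last exact: integrableD.
rewrite integralD//.
rewrite edot adde0 integral_prob_cst integralZl//.
by rewrite EFinD EFinM leeD2l// lee_wpmul2l.
Qed.

End NoiseIntegrals.

(* Conditioning on sigma(S) is realised by seeing T with its sub-sigma-algebra
   sigma(S): the pair (w, X w) then has the product law. *)
Lemma independent_tonelli {R : realType} {dT} {T : measurableType dT}
    (P : probability T R) {dX} {Xi : measurableType dX} (D : probability Xi R)
    (X : {RV P >-> Xi}) (S : set (set T)) (F : T * Xi -> \bar R) :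
  S `<=` measurable ->
  (forall B, measurable B -> distribution P X B = D B) -> independent_of P X S ->
  measurable_fun setT (F : g_sigma_algebraType S * Xi -> \bar R) ->
  (forall p, 0 <= F p)%E ->
  (\int[P]_w F (w, X w) = \int[P]_w \int[D]_s F (w, s))%E.
Proof.
move=> Sm XD XS Fm F0; pose TS : measurableType _ := g_sigma_algebraType S.
have idm : measurable_fun setT (id : T -> TS).
  by apply: (@measurability _ _ T TS setT id S) => // _ [U SU <-]; rewrite setTI; exact: Sm.
have Xm : measurable_fun setT X by [].
have pairm : measurable_fun setT (fun w => (w, X w) : TS * Xi).
  exact: measurable_fun_pair.
have idm' := isMeasurableFun.Build _ _ _ _ _ idm.
pose idf : {mfun T >-> TS} := HB.pack (id : T -> TS) idm'.
pose m1 : probability TS R := distribution P idf.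
pose m2 := pushforward P (fun w => (w, X w) : TS * Xi).
transitivity (\int[m2]_z F z)%E.
  rewrite ge0_integral_pushforward// => y _; exact: F0.
(* Independence is the equality of the two laws on rectangles, which determine a product measure. *)
rewrite (eq_measure_integral (m1 \x D)%E); last first.
  move=> A mA _; apply/esym; apply: product_measure_unique => // B C mB mC.
  rewrite /pushforward /m1 /= /distribution /pushforward /=.
  transitivity (P (X @^-1` C `&` B)); last by rewrite XS// muleC -XD.
  by rewrite setIC.
rewrite fubini_tonelli1// /m1 ge0_integral_pushforward//.
- exact: measurable_fun_fubini_tonelli_F.
- by move=> y _; exact: integral_ge0.
Qed.

(** * Expectations along the iterates *)

Lemma independent_bound {R : realType} {dT} {T : measurableType dT}
    (P : probability T R) {dX} {Xi : measurableType dX} (D : probability Xi R)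
    (X : {RV P >-> Xi}) (S : set (set T)) (F : T * Xi -> R) (B : T -> R) :
  S `<=` measurable ->
  (forall B, measurable B -> distribution P X B = D B) -> independent_of P X S ->
  measurable_fun setT (F : g_sigma_algebraType S * Xi -> R) ->
  measurable_fun setT B -> (forall p, 0 <= F p) ->
  (forall w, (\int[D]_s (F (w, s))%:E <= (B w)%:E)%E) ->
  (\int[P]_w (F (w, X w))%:E <= \int[P]_w (B w)%:E)%E.
Proof.
move=> Sm XD XS Fm Bm F0 FB.
have EFm : measurable_fun setT (EFin \o F : g_sigma_algebraType S * Xi -> \bar R).
  exact/measurable_EFinP.
have F0' p : (0 <= (EFin \o F) p)%E by rewrite lee_fin.
have -> := independent_tonelli Sm XD XS EFm F0'.
apply: ge0_le_integral => //.
- by move=> w _; apply: integral_ge0.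
- move=> _ U mU; have := measurable_fun_fubini_tonelli_F (m2 := D) _ EFm F0' measurableT U mU.
  exact: (smallest_sub (@sigma_algebra_measurable _ T) Sm).
- exact/measurable_EFinP.
- by move=> w _; exact: FB.
Qed.

Section NonnegativeExpectation.
Context {R : realType} {dT} {T : measurableType dT} (P : probability T R).
Implicit Types A B : T -> R.

Lemma integral_EFinD A B : measurable_fun setT A -> measurable_fun setT B ->
  (forall w, 0 <= A w) -> (forall w, 0 <= B w) ->
  (\int[P]_w (A w + B w)%:E = \int[P]_w (A w)%:E + \int[P]_w (B w)%:E)%E.
Proof.
move=> Am Bm A0 B0; under eq_integral do rewrite EFinD.
by rewrite ge0_integralD//; try exact/measurable_EFinP; move=> w _; rewrite lee_fin.
Qed.

Lemma integral_EFinZ A c : measurable_fun setT A -> (forall w, 0 <= A w) -> 0 <= c ->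
  (\int[P]_w (c * A w)%:E = c%:E * \int[P]_w (A w)%:E)%E.
Proof.
move=> Am A0 c0; under eq_integral do rewrite EFinM.
by rewrite ge0_integralZl//; try exact/measurable_EFinP; move=> *; rewrite lee_fin.
Qed.

Lemma integral_EFin_le A B : measurable_fun setT A -> measurable_fun setT B ->
  (forall w, 0 <= A w) -> (forall w, A w <= B w) ->
  (\int[P]_w (A w)%:E <= \int[P]_w (B w)%:E)%E.
Proof.
move=> Am Bm A0 AB; apply: ge0_le_integral => //; try exact/measurable_EFinP.
- by move=> w _; rewrite lee_fin.
- by move=> w _; rewrite lee_fin.
Qed.

Lemma integral_EFin_ge0 A : (forall w, 0 <= A w) -> (0 <= \int[P]_w (A w)%:E)%E.
Proof. by move=> A0; apply: integral_ge0 => w _; rewrite lee_fin. Qed.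

End NonnegativeExpectation.

Section Process.
Context {R : realType} {d n : nat}.
Variables (Phi : 'rV[R]_d -> 'rV[R]_n -> R).
Variables (f : 'rV[R]_d -> \bar R) (h : 'rV[R]_n -> \bar R).
Variables (rho L Lf Lphi Dh sigma : R).
Context {dX : measure_display} {Xi : measurableType dX} (D : probability Xi R).
Variables (g : nat -> 'rV[R]_d -> 'rV[R]_n -> Xi -> 'rV[R]_d).
Variables (G : 'rV[R]_d -> 'rV[R]_n -> Xi -> 'rV[R]_n).
Context {dO : measure_display} {Omega : measurableType dO} (P : probability Omega R).
Variables (xi zeta : nat -> {RV P >-> Xi}).
Variables (x0 : 'rV[R]_d) (y0 : 'rV[R]_n) (eta gam : R).
Variables (x : nat -> Omega -> 'rV[R]_d) (y : nat -> Omega -> 'rV[R]_n).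

(** The history for [zeta k] reaches x_{k+1}, because the ascent gradient is taken at the new x. The
    selection [g k] of a subgradient may change from step to step. *)
Record stochastic_gda : Prop := StochasticGDA {
  g_measurable : forall k, joint_measurable (g k);
  g_unbiased : forall k u v,
    [/\ integrable_vec D (g k u v),
        frechet_subdiff (fun u' => (Phi u' v)%:E) u (mean_vec D (g k u v)) &
        (mean_sqdist D (g k u v) (mean_vec D (g k u v)) <= (sigma ^+ 2)%:E)%E];
  G_measurable : joint_measurable G;
  G_unbiased : forall u v,
    [/\ integrable_vec D (G u v), mean_vec D (G u v) = grad (Phi u) v &
        (mean_sqdist D (G u v) (grad (Phi u) v) <= (sigma ^+ 2)%:E)%E];
  sigma_ge0 : 0 <= sigma;
  eta_gt0 : 0 < eta;
  gam_gt0 : 0 < gam;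
  gam_smooth : 2 * gam * Lphi <= 1;
  x0_dom : dom f x0;
  y0_dom : dom h y0;
  x_init : forall w, x 0%N w = x0;
  y_init : forall w, y 0%N w = y0;
  x_next : forall k w,
    x k.+1 w = prox eta f (x k w - eta *: g k (x k w) (y k w) (xi k w));
  y_next : forall k w,
    y k.+1 w = prox gam h (y k w + gam *: G (x k.+1 w) (y k w) (zeta k w));
  xi_law : forall k B, measurable B -> distribution P (xi k) B = D B;
  zeta_law : forall k B, measurable B -> distribution P (zeta k) B = D B;
  xi_indep : forall k, independent_of P (xi k) (history x y k k);
  zeta_indep : forall k, independent_of P (zeta k) (history x y k.+1 k)
}.

Hypothesis MP : minimax_problem Phi f h rho L Lf Lphi Dh.
Hypothesis SP : stochastic_gda.

Let rho0 : 0 < rho. Proof. by case: MP. Qed.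
Let L0 : 0 <= L. Proof. by case: MP. Qed.
Let Lf0 : 0 <= Lf. Proof. by case: MP. Qed.
Let fc : proper_lsc_convex f. Proof. by case: MP. Qed.
Let hc : proper_lsc_convex h. Proof. by case: MP. Qed.
Let eta0 : 0 < eta. Proof. by case: SP. Qed.
Let gam0 : 0 < gam. Proof. by case: SP. Qed.

Local Notation phi := (phi Phi h).
Local Notation psi := (psi Phi f h).
Local Notation prox_psi := (prox_psi Phi f h rho).
Local Notation env := (env Phi f h rho).
Local Notation gap := (gap Phi h).
Local Notation gbar k u v := (mean_vec D (g k u v)).

Lemma x_dom k w : dom f (x k w).
Proof.
case: k => [|k]; first by rewrite (x_init SP); exact: x0_dom SP.
by rewrite (x_next SP); have [] := proxP fc eta0 (x k w - eta *: g k (x k w) (y k w) (xi k w)).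
Qed.

Lemma y_dom k w : dom h (y k w).
Proof.
case: k => [|k]; first by rewrite (y_init SP); exact: y0_dom SP.
rewrite (y_next SP).
by have [] := proxP hc gam0 (y k w + gam *: G (x k.+1 w) (y k w) (zeta k w)).
Qed.

Lemma gbar_le k u v : dom h v -> enorm (gbar k u v) <= L.
Proof.
move=> hv; have [_ H _] := g_unbiased SP k u v.
by apply: (@frechet_lipschitz _ _ (Phi ^~ v) L u) => // z; exact: (Phi_lipschitz MP).
Qed.

Lemma gbar_subgradient k u v z :
  dotv (gbar k u v) (z - u) <= Phi z v - Phi u v + rho / 2 * enorm (z - u) ^+ 2.
Proof.
have [_ H _] := g_unbiased SP k u v.
apply: (@frechet_weakly_convex _ _ (Phi ^~ v)) => //; first exact: ltW.
exact: (Phi_weakly_convex MP v).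
Qed.

(** * Measurability of the iterates and of the quantities to be averaged *)

Section Measurability.
Context {dT : measure_display} {T : measurableType dT}.

Lemma measurable_x_update k (u : T -> 'rV[R]_d) (v : T -> 'rV[R]_n) (s : T -> Xi) :
  measurable_fun setT (u : T -> @borelV R d) ->
  measurable_fun setT (v : T -> @borelV R n) -> measurable_fun setT s ->
  measurable_fun setT
    (fun t => prox eta f (u t - eta *: g k (u t) (v t) (s t)) : @borelV R d).
Proof.
move=> um vm sm.
apply: (measurable_fun_continuous_comp (continuous_prox fc eta0)
  (v := fun t => u t - eta *: g k (u t) (v t) (s t))).
under eq_fun do rewrite -scaleNr.
apply: measurable_fun_lincomb => //.
exact: measurable_fun_joint (g_measurable SP k) _ _ _.
Qed.

Lemma measurable_y_update (u : T -> 'rV[R]_d) (v : T -> 'rV[R]_n) (s : T -> Xi) :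
  measurable_fun setT (u : T -> @borelV R d) ->
  measurable_fun setT (v : T -> @borelV R n) -> measurable_fun setT s ->
  measurable_fun setT
    (fun t => prox gam h (v t + gam *: G (u t) (v t) (s t)) : @borelV R n).
Proof.
move=> um vm sm.
apply: (measurable_fun_continuous_comp (continuous_prox hc gam0)
  (v := fun t => v t + gam *: G (u t) (v t) (s t))).
apply: measurable_fun_lincomb => //.
exact: measurable_fun_joint (G_measurable SP) _ _ _.
Qed.

Lemma measurable_phi (u : T -> 'rV[R]_d) :
  measurable_fun setT (u : T -> @borelV R d) -> measurable_fun setT (fun t => phi (u t)).
Proof. exact: (measurable_fun_real_continuous_comp (continuous_phi MP)). Qed.

Lemma measurable_psi (u : T -> 'rV[R]_d) :
  measurable_fun setT (u : T -> @borelV R d) -> measurable_fun setT (fun t => psi (u t)).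
Proof.
move=> um; apply: measurable_funD; last exact: measurable_phi.
by have [_ lsc _] := fc; exact: measurable_fun_lsc_comp.
Qed.

Lemma measurable_prox_psi (u : T -> 'rV[R]_d) :
  measurable_fun setT (u : T -> @borelV R d) ->
  measurable_fun setT (fun t => prox_psi (u t) : @borelV R d).
Proof. exact: (measurable_fun_continuous_comp (continuous_prox_psi MP)). Qed.

Lemma measurable_smoothed_argmax alpha (u : T -> 'rV[R]_d) : 0 < alpha ->
  measurable_fun setT (u : T -> @borelV R d) ->
  measurable_fun setT (fun t => smoothed_argmax Phi h alpha y0 (u t) : @borelV R n).
Proof.
move=> alpha0.
exact: (measurable_fun_continuous_comp (continuous_smoothed_argmax MP alpha0)).
Qed.

Lemma measurable_prox_psi_dist (u : T -> 'rV[R]_d) :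
  measurable_fun setT (u : T -> @borelV R d) ->
  measurable_fun setT (fun t => rho ^+ 2 * enorm (prox_psi (u t) - u t) ^+ 2).
Proof.
move=> um; apply: measurable_funM => //; apply: measurable_funX.
by apply: measurable_fun_enormB => //; exact: measurable_prox_psi.
Qed.

Lemma measurable_env (u : T -> 'rV[R]_d) :
  measurable_fun setT (u : T -> @borelV R d) -> measurable_fun setT (fun t => env (u t)).
Proof.
move=> um; have pm := measurable_prox_psi um.
apply: measurable_funD; first exact: measurable_psi.
by apply: measurable_funM => //; apply: measurable_funX; exact: measurable_fun_enormB.
Qed.

Lemma measurable_gap (u : T -> 'rV[R]_d) (v : T -> 'rV[R]_n) :
  measurable_fun setT (u : T -> @borelV R d) ->
  measurable_fun setT (v : T -> @borelV R n) -> (forall t, dom h (v t)) ->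
  measurable_fun setT (fun t => gap (u t) (v t)).
Proof.
move=> um vm vh; apply: measurable_funB; first exact: measurable_phi.
apply: measurable_funB.
  exact: measurable_fun_lipschitz_continuous L0 (continuous_Phi MP) (Phi_lipschitz MP)
    um vm vh.
by have [_ lsc _] := hc; exact: measurable_fun_lsc_comp.
Qed.

End Measurability.

Lemma measurable_xy k : measurable_fun setT (x k : Omega -> @borelV R d) /\
  measurable_fun setT (y k : Omega -> @borelV R n).
Proof.
elim: k => [|k [xm ym]].
  have -> : x 0%N = cst x0 by apply/funext => w; exact: x_init SP _.
  have -> : y 0%N = cst y0 by apply/funext => w; exact: y_init SP _.
  by split; exact: measurable_cst.
have xm' : measurable_fun setT (x k.+1 : Omega -> @borelV R d).
  have -> : x k.+1 = fun w => prox eta f (x k w - eta *: g k (x k w) (y k w) (xi k w)).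
    by apply/funext => w; exact: x_next SP _ _.
  exact: measurable_x_update.
split => //.
have -> : y k.+1 = fun w => prox gam h (y k w + gam *: G (x k.+1 w) (y k w) (zeta k w)).
  by apply/funext => w; exact: y_next SP _ _.
exact: measurable_y_update.
Qed.

Let xm k := (measurable_xy k).1.
Let ym k := (measurable_xy k).2.

Lemma history_measurable p q : history x y p q `<=` measurable.
Proof.
move=> _ [[i [U [_ oU ->]]]|[j [V [_ oV ->]]]]; rewrite -[X in measurable X]setTI.
  by apply: xm => //; exact: sub_sigma_algebra.
by apply: ym => //; exact: sub_sigma_algebra.
Qed.

Section HistoryMeasurability.
Variables (p q : nat).
Local Notation TS := (g_sigma_algebraType (history x y p q)).

(** Measurability is meant here for the sigma-algebra of the past times that of the fresh sample, as
    [independent_bound] requires. *)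
Lemma measurable_history_x i : (i <= p)%N ->
  measurable_fun setT ((fun z => x i z.1) : TS * Xi -> @borelV R d).
Proof.
move=> ip; apply: (@measurableT_comp _ _ _ _ _ _ (x i : TS -> @borelV R d) _ fst) => //.
apply: (@measurability _ _ TS (@borelV R d) setT (x i) open) => // _ [U oU <-].
by rewrite setTI; apply: sub_sigma_algebra; left; exists i, U.
Qed.

Lemma measurable_history_y j : (j <= q)%N ->
  measurable_fun setT ((fun z => y j z.1) : TS * Xi -> @borelV R n).
Proof.
move=> jq; apply: (@measurableT_comp _ _ _ _ _ _ (y j : TS -> @borelV R n) _ fst) => //.
apply: (@measurability _ _ TS (@borelV R n) setT (y j) open) => // _ [V oV <-].
by rewrite setTI; apply: sub_sigma_algebra; right; exists j, V.
Qed.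

End HistoryMeasurability.

(** * The one-step inequalities in expectation *)

Section Expectations.
Variable m : R.
Hypothesis psi_ge : forall u, dom f u -> m <= psi u.

Lemma env_ge u : m <= env u.
Proof.
have [fz _] := prox_psiP MP u; rewrite (le_trans (psi_ge fz))// lerDl.
by rewrite mulr_ge0 ?sqr_ge0// ltW.
Qed.

Definition mean_psi k := (\int[P]_w (psi (x k w) - m)%:E)%E.
Definition mean_env k := (\int[P]_w (env (x k w) - m)%:E)%E.
(** A quarter of the mean squared norm of the gradient of the envelope. *)
Definition mean_dist k :=
  (\int[P]_w (rho ^+ 2 * enorm (prox_psi (x k w) - x k w) ^+ 2)%:E)%E.
Definition mean_gap k := (\int[P]_w (gap (x k w) (y k w))%:E)%E.

Let dist_ge0 u : 0 <= rho ^+ 2 * enorm (prox_psi u - u) ^+ 2.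
Proof. by rewrite mulr_ge0// sqr_ge0. Qed.

Lemma mean_dist_ge0 k : (0 <= mean_dist k)%E.
Proof. exact: integral_EFin_ge0. Qed.

Lemma mean_env_ge0 k : (0 <= mean_env k)%E.
Proof. by apply: integral_EFin_ge0 => w; rewrite subr_ge0 env_ge. Qed.

Lemma mean_psi_ge0 k : (0 <= mean_psi k)%E.
Proof. by apply: integral_EFin_ge0 => w; rewrite subr_ge0 psi_ge//; exact: x_dom. Qed.

Lemma mean_env_le_psi k : (mean_env k <= mean_psi k)%E.
Proof.
apply: integral_EFin_le.
- by apply: measurable_funB => //; exact: measurable_env.
- by apply: measurable_funB => //; exact: measurable_psi.
- by move=> w; rewrite subr_ge0 env_ge.
- move=> w; rewrite lerD2r; apply: le_trans (env_psi_le MP (x_dom k w)).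
  by rewrite lerDl mulr_ge0 ?sqr_ge0// divr_ge0// ltW.
Qed.

Lemma mean_dist_le_psi k : (mean_dist k <= rho%:E * mean_psi k)%E.
Proof.
rewrite /mean_psi /mean_dist -integral_EFinZ ?(ltW rho0)//; last 2 first.
- by apply: measurable_funB => //; exact: measurable_psi.
- by move=> w; rewrite subr_ge0 psi_ge//; exact: x_dom.
apply: integral_EFin_le => //.
- exact: measurable_prox_psi_dist.
- by apply: measurable_funM => //; apply: measurable_funB => //; exact: measurable_psi.
- move=> w; rewrite expr2 -mulrA ler_pM2l//.
  have := env_psi_le MP (x_dom k w); rewrite /env.
  have [fz _] := prox_psiP MP (x k w); have := psi_ge fz.
  have : 0 <= rho / 2 * enorm (prox_psi (x k w) - x k w) ^+ 2.
    by rewrite mulr_ge0 ?sqr_ge0// divr_ge0// ltW.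
  lra.
Qed.

Lemma mean_psi_init : mean_psi 0%N = (psi x0 - m)%:E.
Proof.
rewrite /mean_psi -[RHS](integral_prob_cst P).
by apply: eq_integral => w _; rewrite (x_init SP).
Qed.

(** Measurability of F is asked over every space T since F is integrated twice: over past and sample
    jointly, and over the sample alone with the past frozen. *)
Lemma x_step_expectation k (F : 'rV[R]_d -> 'rV[R]_d -> R) (B : Omega -> R) (c : R)
    (a : Omega -> 'rV[R]_d) :
  0 <= c ->
  (forall dT (T : measurableType dT) (u v : T -> 'rV[R]_d),
    measurable_fun setT (u : T -> @borelV R d) ->
    measurable_fun setT (v : T -> @borelV R d) ->
    measurable_fun setT (fun t => F (u t) (v t))) ->
  (forall u v, dom f u -> dom f v -> 0 <= F u v) ->
  measurable_fun setT B ->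
  (forall w gs,
    let noise := gs - gbar k (x k w) (y k w) in
    F (x k w) (prox eta f (x k w - eta *: gs)) <=
      B w + c * enorm noise ^+ 2 + dotv noise (a w)) ->
  (\int[P]_w (F (x k w) (x k.+1 w))%:E <= \int[P]_w (B w + c * sigma ^+ 2)%:E)%E.
Proof.
move=> c0 Fm F0 Bm FB.
pose F' (z : Omega * Xi) :=
  F (x k z.1) (prox eta f (x k z.1 - eta *: g k (x k z.1) (y k z.1) z.2)).
have F'0 z : 0 <= F' z.
  apply: F0; first exact: x_dom.
  by have [] := proxP fc eta0 (x k z.1 - eta *: g k (x k z.1) (y k z.1) z.2).
under eq_integral do rewrite (x_next SP).
apply: (independent_bound (F := F') (B := fun w => B w + c * sigma ^+ 2)
  (@history_measurable k k) (@xi_law SP k) (@xi_indep SP k)) => //.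
- have xm' := @measurable_history_x k k k (leqnn k).
  apply: Fm => //; apply: measurable_x_update => //.
  exact: measurable_history_y (leqnn k).
- exact: measurable_funD.
move=> w; have [gI _ gS] := g_unbiased SP k (x k w) (y k w).
apply: (@noise_bound _ _ _ D _ _ sigma gI gS (a w) (B w) c (fun s => F' (w, s)) c0) => //.
- apply: (Fm _ _ (fun=> x k w)); first exact: measurable_borel_cst.
  exact: (measurable_x_update k (measurable_borel_cst (x k w))
    (measurable_borel_cst (y k w)) (@measurable_id _ Xi setT)).
- by move=> s; exact: FB.
Qed.

Lemma mean_psi_step k :
  (mean_psi k.+1 + (eta / 4)%:E * mean_dist k.+1 <=
   mean_psi k + (5 * eta * (L ^+ 2 + sigma ^+ 2))%:E)%E.
Proof.
have e40 : 0 <= eta / 4 by rewrite divr_ge0// ltW.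
have e50 : 0 <= 5 * eta by rewrite mulr_ge0// ltW.
have c0 : 0 <= 5 * eta * (L ^+ 2 + sigma ^+ 2).
  by rewrite mulr_ge0 ?addr_ge0 ?sqr_ge0.
have pm u : dom f u -> 0 <= psi u - m by move=> fu; rewrite subr_ge0 psi_ge.
have pmm dT (T : measurableType dT) (u : T -> 'rV[R]_d) :
    measurable_fun setT (u : T -> @borelV R d) ->
    measurable_fun setT (fun t => psi (u t) - m).
  by move=> um; apply: measurable_funB => //; exact: measurable_psi.
have pw k' w : 0 <= psi (x k' w) - m by apply: pm; exact: x_dom.
have dm dT (T : measurableType dT) (u : T -> 'rV[R]_d) :
    measurable_fun setT (u : T -> @borelV R d) ->
    measurable_fun setT (fun t => eta / 4 * (rho ^+ 2 * enorm (prox_psi (u t) - u t) ^+ 2)).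
  by move=> um; apply: measurable_funM => //; exact: measurable_prox_psi_dist.
rewrite -integral_EFinZ//; last exact: measurable_prox_psi_dist.
rewrite -integral_EFinD//; [|exact: pmm|exact: dm|by move=> w; rewrite mulr_ge0].
rewrite -[X in (_ <= _ + X)%E](integral_prob_cst P) -integral_EFinD//; last exact: pmm.
under [leRHS]eq_integral do rewrite mulrDr addrA.
apply: (@x_step_expectation k
  (fun _ p => psi p - m + eta / 4 * (rho ^+ 2 * enorm (prox_psi p - p) ^+ 2))
  (fun w => psi (x k w) - m + 5 * eta * L ^+ 2) (5 * eta) (fun=> 0)) => //.
- by move=> dT T u v _ vm; apply: measurable_funD; [exact: pmm|exact: dm].
- by move=> u v _ fv; rewrite addr_ge0 ?pm// mulr_ge0.
- by apply: measurable_funD => //; exact: pmm.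
- move=> w gs /=; rewrite dotvC dotv0l addr0.
  have := psi_step MP gs eta0 (gbar_le k (x k w) (y_dom k w)) (x_dom k w).
  lra.
Qed.

Lemma mean_env_step k (Gam : Omega -> R) : 4 * (eta * rho) <= 1 ->
  measurable_fun setT Gam -> (forall w, 0 <= Gam w) ->
  (forall w, dotv (gbar k (x k w) (y k w)) (prox_psi (x k w) - x k w) <=
     phi (prox_psi (x k w)) - phi (x k w) + Gam w
     + rho / 2 * enorm (prox_psi (x k w) - x k w) ^+ 2) ->
  (mean_env k.+1 + eta%:E * mean_dist k <= mean_env k
    + (2 * (rho * eta))%:E * \int[P]_w (Gam w)%:E
    + (16 * rho * eta ^+ 2 * (L ^+ 2 + sigma ^+ 2))%:E)%E.
Proof.
move=> etarho Gm G0 HG.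
have re0 : 0 <= 2 * (rho * eta) by rewrite mulr_ge0// mulr_ge0// ltW.
have e16 : 0 <= 16 * rho * eta ^+ 2 by rewrite mulr_ge0 ?sqr_ge0// mulr_ge0// ltW.
have c0 : 0 <= 16 * rho * eta ^+ 2 * (L ^+ 2 + sigma ^+ 2).
  by rewrite mulr_ge0 ?addr_ge0 ?sqr_ge0.
have eg u : 0 <= env u - m by rewrite subr_ge0 env_ge.
have em dT (T : measurableType dT) (u : T -> 'rV[R]_d) :
    measurable_fun setT (u : T -> @borelV R d) ->
    measurable_fun setT (fun t => env (u t) - m).
  by move=> um; apply: measurable_funB => //; exact: measurable_env.
have dm dT (T : measurableType dT) (u : T -> 'rV[R]_d) :
    measurable_fun setT (u : T -> @borelV R d) ->
    measurable_fun setT (fun t => eta * (rho ^+ 2 * enorm (prox_psi (u t) - u t) ^+ 2)).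
  by move=> um; apply: measurable_funM => //; exact: measurable_prox_psi_dist.
have d0 u : 0 <= eta * (rho ^+ 2 * enorm (prox_psi u - u) ^+ 2).
  by rewrite mulr_ge0// ltW.
have Gm' : measurable_fun setT (fun w => 2 * (rho * eta) * Gam w).
  exact: measurable_funM.
have Gw w : 0 <= 2 * (rho * eta) * Gam w by rewrite mulr_ge0.
rewrite -integral_EFinZ ?(ltW eta0)//; last exact: measurable_prox_psi_dist.
rewrite -integral_EFinD//; [|exact: em|exact: dm].
rewrite -integral_EFinZ// -integral_EFinD//; last exact: em.
rewrite -[X in (_ <= _ + X)%E](integral_prob_cst P) -integral_EFinD//; last 2 first.
- by apply: measurable_funD => //; exact: em.
- by move=> w; rewrite addr_ge0.
under [leRHS]eq_integral do rewrite (mulrDr (16 * rho * eta ^+ 2)) addrA.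
apply: (@x_step_expectation k
  (fun u p => env p - m + eta * (rho ^+ 2 * enorm (prox_psi u - u) ^+ 2))
  (fun w => env (x k w) - m + 2 * (rho * eta) * Gam w + 16 * rho * eta ^+ 2 * L ^+ 2)
  (16 * rho * eta ^+ 2) (fun w => (2 * (rho * eta)) *: (prox_psi (x k w) - x k w))) => //.
- by move=> dT T u v um vm; apply: measurable_funD; [exact: em|exact: dm].
- by move=> u v _ _; rewrite addr_ge0.
- by apply: measurable_funD => //; apply: measurable_funD => //; exact: em.
- move=> w gs /=; rewrite dotvZr.
  have := env_step MP gs eta0 (gbar_le k (x k w) (y_dom k w)) etarho (HG w).
  lra.
Qed.

Lemma mean_increment k : 0 < L ->
  (\int[P]_w (enorm (x k.+1 w - x k w))%:E <= (2 * eta * (L + Lf + sigma))%:E)%E.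
Proof.
move=> Lp; have s0 := sigma_ge0 SP.
(* The first moment of the noise is bounded through e <= e^2 / (2 b) + b / 2. This b is positive
   thanks to L > 0, even for sigma = 0, and satisfies sigma^2 / b <= b. *)
pose b := L + sigma; have b0 : 0 < b by rewrite ltr_pwDl.
have c0 : 0 <= eta / (2 * b) by rewrite divr_ge0// ?mulr_ge0// ltW.
apply: (@le_trans _ _
  (\int[P]_w (eta * (Lf + L + b / 2) + eta / (2 * b) * sigma ^+ 2)%:E)%E); last first.
  rewrite integral_prob_cst lee_fin.
  have : sigma ^+ 2 / b <= b.
    by rewrite ler_pdivrMr// -expr2 ler_pXn2r// ?nnegrE ?lerDr// ltW.
  rewrite (_ : eta / (2 * b) * sigma ^+ 2 = eta / 2 * (sigma ^+ 2 / b)); last first.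
    by field; rewrite gt_eqF.
  have e20 : 0 <= eta / 2 by rewrite divr_ge0// ltW.
  move=> /(ler_wpM2l e20).
  have : eta * (2 * L + Lf + sigma) <= eta * (2 * (L + Lf + sigma)).
    by rewrite ler_pM2l//; have Lf0' := Lf0; lra.
  by rewrite /b; lra.
apply: (@x_step_expectation k (fun u p => enorm (p - u)) _ _ (fun=> 0)) => //.
- by move=> dT T u v um vm; exact: measurable_fun_enormB.
- by move=> u v _ _; exact: enorm_ge0.
- move=> w gs /=; rewrite dotvC dotv0l addr0.
  have := prox_step_norm MP gs eta0 (x_dom k w).
  have := gbar_le k (x k w) (y_dom k w).
  set e := enorm (gs - _) => gL H.
  have gsL : enorm gs <= L + e.
    rewrite -[gs](subrK (gbar k (x k w) (y k w))) addrC.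
    by rewrite (le_trans (ler_enormD _ _))// lerD2r.
  apply: (le_trans H); rewrite mulrAC -mulrA -mulrDr ler_pM2l//.
  have : 0 <= (e - b) ^+ 2 / (2 * b) by rewrite divr_ge0 ?sqr_ge0// mulr_ge0// ltW.
  have -> : (e - b) ^+ 2 / (2 * b) = (2 * b)^-1 * e ^+ 2 - e + b / 2.
    by field; rewrite gt_eqF.
  lra.
Qed.

Section Comparison.
Variables (alpha : R) (j : nat).
Hypothesis alpha0 : 0 < alpha.

Local Notation ystar := (smoothed_argmax Phi h alpha y0).

Definition mean_dist_star k :=
  (\int[P]_w ((2 * gam)^-1 * enorm (ystar (x j w) - y k w) ^+ 2)%:E)%E.

Let g20 : 0 <= (2 * gam)^-1. Proof. by rewrite invr_ge0 mulr_ge0// ltW. Qed.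

Lemma mean_dist_star_le k : (mean_dist_star k <= (Dh ^+ 2 / (2 * gam))%:E)%E.
Proof.
rewrite /mean_dist_star -(integral_prob_cst P); apply: integral_EFin_le => //.
- apply: measurable_funM => //; apply: measurable_funX; apply: measurable_fun_enormB => //.
  exact: measurable_smoothed_argmax.
- by move=> w; rewrite mulr_ge0 ?sqr_ge0.
- move=> w; rewrite mulrC ler_wpM2r//.
  have [hu _] := smoothed_argmaxP MP y0 alpha0 (x j w).
  have H := dom_h_bounded MP hu (y_dom k w).
  by rewrite ler_pXn2r// nnegrE ?enorm_ge0// (le_trans _ H)// enorm_ge0.
Qed.

(** The condition on j places the comparison point in the history seen by [zeta k], so the noise is
    centred against y_k - ystar(x_j). *)
Lemma mean_gap_step k : (j <= k.+1)%N ->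
  (mean_gap k.+1 + mean_dist_star k.+1 <= mean_dist_star k
   + ((alpha * Dh ^+ 2 + gam * sigma ^+ 2)%:E
      + (2 * L)%:E * \int[P]_w (enorm (x k.+1 w - x j w))%:E))%E.
Proof.
move=> jk.
have um' dT (T : measurableType dT) (u : T -> 'rV[R]_d) :
    measurable_fun setT (u : T -> @borelV R d) ->
    measurable_fun setT (fun t => ystar (u t) : @borelV R n).
  exact: measurable_smoothed_argmax.
have sm dT (T : measurableType dT) (u : T -> 'rV[R]_d) (v : T -> 'rV[R]_n) :
    measurable_fun setT (u : T -> @borelV R d) ->
    measurable_fun setT (v : T -> @borelV R n) ->
    measurable_fun setT (fun t => (2 * gam)^-1 * enorm (ystar (u t) - v t) ^+ 2).
  move=> um vm; apply: measurable_funM => //; apply: measurable_funX.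
  by apply: measurable_fun_enormB => //; exact: um'.
have s0 u v : 0 <= (2 * gam)^-1 * enorm (ystar u - v) ^+ 2 by rewrite mulr_ge0 ?sqr_ge0.
have L20 : 0 <= 2 * L by rewrite mulr_ge0.
have c0 : 0 <= alpha * Dh ^+ 2 + gam * sigma ^+ 2.
  by rewrite addr_ge0// mulr_ge0 ?sqr_ge0// ltW.
have g0 w k' : 0 <= gap (x k' w) (y k' w) by apply: (gap_ge0 MP); exact: y_dom.
have im : measurable_fun setT (fun w => 2 * L * enorm (x k.+1 w - x j w)).
  by apply: measurable_funM => //; exact: measurable_fun_enormB.
rewrite -integral_EFinD//; [|by apply: measurable_gap => // w; exact: y_dom|exact: sm].
rewrite -integral_EFinZ//; [|exact: measurable_fun_enormB|by move=> w; exact: enorm_ge0].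
rewrite -[X in (_ <= _ + (X + _))%E](integral_prob_cst P).
have i0 w : 0 <= 2 * L * enorm (x k.+1 w - x j w) by rewrite mulr_ge0 ?enorm_ge0.
rewrite -integral_EFinD// -integral_EFinD//; last 3 first.
- exact: sm.
- exact: measurable_funD.
- by move=> w; rewrite addr_ge0.
pose yn (z : Omega * Xi) := prox gam h
  (y k z.1 + gam *: G (x k.+1 z.1) (y k z.1) z.2).
have hyn z : dom h (yn z).
  by have [] := proxP hc gam0 (y k z.1 + gam *: G (x k.+1 z.1) (y k z.1) z.2).
pose F z := gap (x k.+1 z.1) (yn z) + (2 * gam)^-1 * enorm (ystar (x j z.1) - yn z) ^+ 2.
have F0 z : 0 <= F z by rewrite /F addr_ge0// (gap_ge0 MP).
under eq_integral do rewrite (y_next SP).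
apply: (independent_bound (F := F) (B := fun w =>
    (2 * gam)^-1 * enorm (ystar (x j w) - y k w) ^+ 2
    + (alpha * Dh ^+ 2 + gam * sigma ^+ 2 + 2 * L * enorm (x k.+1 w - x j w)))
  (@history_measurable k.+1 k) (@zeta_law SP k) (@zeta_indep SP k)) => //.
- have xm1 := @measurable_history_x k.+1 k k.+1 (leqnn _).
  have ynm := measurable_y_update xm1 (@measurable_history_y k.+1 k k (leqnn _))
    (@measurable_snd _ _ _ _).
  apply: measurable_funD; first exact: measurable_gap.
  apply: sm ynm; exact: (measurable_history_x jk).
- by apply: measurable_funD; [exact: sm|exact: measurable_funD].
move=> w; have [GI GE GS] := G_unbiased SP (x k.+1 w) (y k w).
rewrite -GE in GS; have [hu _] := smoothed_argmaxP MP y0 alpha0 (x j w).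
rewrite [X in (_ <= X%:E)%E](_ : _ = (2 * gam)^-1 * enorm (ystar (x j w) - y k w) ^+ 2
  + alpha * Dh ^+ 2 + 2 * L * enorm (x k.+1 w - x j w) + gam * sigma ^+ 2); last by lra.
apply: (@noise_bound _ _ _ D _ _ sigma GI GS (y k w - ystar (x j w)) _ gam
  (fun s => F (w, s)) (ltW gam0)) => //.
- have ynm := measurable_y_update (measurable_borel_cst (x k.+1 w))
    (measurable_borel_cst (y k w)) (@measurable_id _ _ _).
  apply: measurable_funD.
    exact: (measurable_gap (measurable_borel_cst (x k.+1 w)) ynm (fun s => hyn (w, s))).
  exact: (sm _ _ _ _ (measurable_borel_cst (x j w)) ynm).
- move=> s; rewrite /F /= GE.
  have := ascent_step MP (x k.+1 w) (y k w) (G (x k.+1 w) (y k w) s) gam0 (gam_smooth SP) hu.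
  have := smoothed_argmax_gap MP (x j w) (x k.+1 w) alpha0 (y0_dom SP).
  rewrite /yn /=; lra.
Qed.

End Comparison.

End Expectations.

End Process.

(** * Counting iterations *)

Lemma telescope_le {R : realType} (a r b : nat -> \bar R) K :
  (forall k, (k < K)%N -> a k.+1 + r k <= a k + b k)%E ->
  (a K + \sum_(k < K) r k <= a 0%N + \sum_(k < K) b k)%E.
Proof.
elim: K => [|K IH] H; first by rewrite !big_ord0.
rewrite !big_ord_recr/= (addeC (\sum_(k < K) r k)%E) addeA.
apply: (@le_trans _ _ (a K + b K + \sum_(k < K) r k)%E).
  by rewrite leeD2r// H.
rewrite addeAC addeA leeD2r// IH// => k kK; apply: H; exact: ltnW.
Qed.

Lemma sum_EFin_const {R : realType} (c : R) K :
  (\sum_(k < K) c%:E = (K%:R * c)%:E :> \bar R)%E.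
Proof. by rewrite sumEFin sumr_const card_ord mulr_natl. Qed.

Lemma floor_nat {R : realType} (r : R) : 0 <= r -> exists k : nat, k%:R <= r < k.+1%:R.
Proof. by move=> r0; exists (Num.truncn r); exact: Num.Theory.truncn_itv. Qed.

Section Complexity.
Context {R : realType} {d n : nat}.
Variables (Phi : 'rV[R]_d -> 'rV[R]_n -> R).
Variables (f : 'rV[R]_d -> \bar R) (h : 'rV[R]_n -> \bar R).
Variables (rho L Lf Lphi Dh sigma : R).
Context {dX : measure_display} {Xi : measurableType dX} (D : probability Xi R).
Variables (g : nat -> 'rV[R]_d -> 'rV[R]_n -> Xi -> 'rV[R]_d).
Variables (G : 'rV[R]_d -> 'rV[R]_n -> Xi -> 'rV[R]_n).
Context {dO : measure_display} {Omega : measurableType dO} (P : probability Omega R).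
Variables (xi zeta : nat -> {RV P >-> Xi}).
Variables (x0 : 'rV[R]_d) (y0 : 'rV[R]_n) (eta gam : R).
Variables (x : nat -> Omega -> 'rV[R]_d) (y : nat -> Omega -> 'rV[R]_n).
Hypothesis MP : minimax_problem Phi f h rho L Lf Lphi Dh.
Hypothesis SP : stochastic_gda Phi f h Lphi sigma D g G xi zeta x0 y0 eta gam x y.
Variables (m e : R).
Hypothesis psi_ge : forall u, dom f u -> m <= psi Phi f h u.
Hypothesis e0 : 0 < e.

Local Notation M := (L + Lf + sigma).
Hypothesis eta_le : eta * rho * (L ^+ 2 + sigma ^+ 2) <= e ^+ 2.
Hypothesis eta_gam_le : eta * rho ^+ 2 * (L * M) * Dh ^+ 2 <= 3 * e ^+ 4 * gam.
Hypothesis gam_le : gam * rho * sigma ^+ 2 <= e ^+ 2.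

Let Del := psi Phi f h x0 - m.
Let T := Del / (eta * e ^+ 2).

Local Notation mean_psi := (mean_psi Phi f h P x m).
Local Notation mean_env := (mean_env Phi f h rho P x m).
Local Notation mean_dist := (mean_dist Phi f h rho P x).
Local Notation mean_gap := (mean_gap Phi h P x y).

Let rho0 : 0 < rho. Proof. by case: MP. Qed.
Let L0 : 0 <= L. Proof. by case: MP. Qed.
Let Lf0 : 0 <= Lf. Proof. by case: MP. Qed.
Let sigma0 : 0 <= sigma. Proof. by case: SP. Qed.
Let eta0 : 0 < eta. Proof. by case: SP. Qed.
Let gam0 : 0 < gam. Proof. by case: SP. Qed.
Let e20 : 0 < e ^+ 2. Proof. by rewrite exprn_gt0. Qed.
Let Del0 : 0 <= Del.
Proof. by rewrite subr_ge0 psi_ge//; case: SP. Qed.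
Let T0 : 0 <= T.
Proof. by rewrite divr_ge0// mulr_ge0// ltW. Qed.
Let DelE : Del = T * (eta * e ^+ 2).
Proof. by rewrite /T divfK// gt_eqF// mulr_gt0. Qed.
Let N0 : 0 <= L ^+ 2 + sigma ^+ 2.
Proof. by rewrite addr_ge0// sqr_ge0. Qed.

(** The averages start at x_1, as the minimum in the theorem does; this pays for the first step. *)
Let mean_psi1 : (mean_psi 1%N <= (Del + 5 * eta * (L ^+ 2 + sigma ^+ 2))%:E)%E.
Proof.
have := mean_psi_step MP SP psi_ge 0; rewrite (mean_psi_init SP) -EFinD.
apply: le_trans; rewrite leeDl// mule_ge0 ?(mean_dist_ge0)//.
by rewrite lee_fin divr_ge0// ltW.
Qed.

Let scaled_sum (c X : R) (a : nat -> \bar R) K : 0 < c ->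
  (forall k, 0 <= a k)%E -> (\sum_(k < K) c%:E * a k <= (c * X)%:E)%E ->
  (\sum_(k < K) a k <= X%:E)%E.
Proof.
by move=> c0 a0; rewrite -ge0_sume_distrr// EFinM lee_pmul2l// fin_numElt ltNyr ltry.
Qed.

Let near_minimizer : rho * Del <= e ^+ 2 ->
  (mean_dist 1%N <= (100 * e ^+ 2)%:E)%E.
Proof.
move=> small; apply: (le_trans (mean_dist_le_psi MP SP psi_ge 1%N)).
apply: (@le_trans _ _ (rho%:E * (Del + 5 * eta * (L ^+ 2 + sigma ^+ 2))%:E)%E).
  by rewrite lee_pmul2l.
by rewrite -EFinM lee_fin; have := e20; have := eta_le; lra.
Qed.

Let large_step K : L <= 2 * e -> 1 <= 4 * (eta * rho) -> T <= K%:R ->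
  (\sum_(k < K) mean_dist k.+1 <= (K%:R * (100 * e ^+ 2))%:E)%E.
Proof.
move=> Le etarho TK.
apply: (@scaled_sum (eta / 4) _ (fun k => mean_dist k.+1)); first by rewrite divr_gt0.
  by move=> k; exact: mean_dist_ge0.
have := @telescope_le _ mean_psi (fun k => (eta / 4)%:E * mean_dist k.+1)%E
  (fun=> (5 * eta * (L ^+ 2 + sigma ^+ 2))%:E) K
  (fun k _ => mean_psi_step MP SP psi_ge k).
rewrite sum_EFin_const (mean_psi_init SP) -EFinD => H.
apply: (@le_trans _ _ (mean_psi K + \sum_(k < K) (eta / 4)%:E * mean_dist k.+1)%E).
  by rewrite leeDr//; exact: (mean_psi_ge0 MP SP).
apply: (le_trans H); rewrite lee_fin -/Del DelE.
have K0 : 0 <= K%:R * eta by rewrite mulr_ge0// ltW.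
have N4 : L ^+ 2 + sigma ^+ 2 <= 4 * e ^+ 2.
  by have := ler_wpM2r N0 etarho; have := eta_le; lra.
have H1 := ler_wpM2l K0 N4.
have H2 : T * (eta * e ^+ 2) <= K%:R * (eta * e ^+ 2) by rewrite ler_pM2r// mulr_gt0.
have H3 : 0 <= K%:R * eta * e ^+ 2 by rewrite mulr_ge0// ltW.
lra.
Qed.

Let small_step K (Gam : nat -> Omega -> R) : e ^+ 2 <= rho * Del ->
  4 * (eta * rho) <= 1 -> T <= K%:R ->
  (forall k, measurable_fun setT (Gam k)) -> (forall k w, 0 <= Gam k w) ->
  (forall k w,
     dotv (mean_vec D (g k (x k w) (y k w))) (prox_psi Phi f h rho (x k w) - x k w) <=
     phi Phi h (prox_psi Phi f h rho (x k w)) - phi Phi h (x k w) + Gam k w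
     + rho / 2 * enorm (prox_psi Phi f h rho (x k w) - x k w) ^+ 2) ->
  (\sum_(k < K) \int[P]_w (Gam k.+1 w)%:E <= (K%:R * (8 * e ^+ 2 / rho))%:E)%E ->
  (\sum_(k < K) mean_dist k.+1 <= (K%:R * (100 * e ^+ 2))%:E)%E.
Proof.
move=> big etarho TK Gm G0 HG GS.
apply: (@scaled_sum eta _ (fun k => mean_dist k.+1)); [by []|by move=> k; exact: mean_dist_ge0|].
have H := @telescope_le _ (fun k => mean_env k.+1) (fun k => eta%:E * mean_dist k.+1)%E
  (fun k => (2 * (rho * eta))%:E * \int[P]_w (Gam k.+1 w)%:E
    + (16 * rho * eta ^+ 2 * (L ^+ 2 + sigma ^+ 2))%:E)%E K.
apply: (@le_trans _ _ (mean_env K.+1 + \sum_(k < K) eta%:E * mean_dist k.+1)%E).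
  by rewrite leeDr//; exact: (mean_env_ge0 _ _ MP).
apply: (le_trans (H _)).
  by move=> k _; rewrite addeA; exact: (mean_env_step MP SP psi_ge etarho (Gm _) (G0 _) (HG _)).
rewrite big_split/= sum_EFin_const -ge0_sume_distrr; last first.
  by move=> k _; exact: integral_EFin_ge0.
have re0 : 0 <= 2 * (rho * eta) by rewrite mulr_ge0// mulr_ge0// ltW.
apply: (@le_trans _ _ ((Del + 5 * eta * (L ^+ 2 + sigma ^+ 2))%:E
   + ((2 * (rho * eta))%:E * (K%:R * (8 * e ^+ 2 / rho))%:E
   + (K%:R * (16 * rho * eta ^+ 2 * (L ^+ 2 + sigma ^+ 2)))%:E))%E).
  apply: leeD; last by rewrite leeD2r// lee_wpmul2l.
  exact: le_trans (mean_env_le_psi MP SP psi_ge 1%N) mean_psi1.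
rewrite -EFinM -!EFinD lee_fin.
have -> : 2 * (rho * eta) * (K%:R * (8 * e ^+ 2 / rho)) = 16 * (K%:R * (eta * e ^+ 2)).
  by field; rewrite gt_eqF.
have DK : Del <= K%:R * (eta * e ^+ 2) by rewrite DelE ler_pM2r// mulr_gt0.
have K0 : 0 <= K%:R * eta by rewrite mulr_ge0// ltW.
have H1 := ler_wpM2l K0 eta_le.
(* Here e^2 <= rho Del lets the cost of the first step be charged to the initial decrease. *)
have H2 : 5 * eta * (L ^+ 2 + sigma ^+ 2) <= 5 * Del.
  by rewrite -(ler_pM2l rho0); have := eta_le; lra.
have H3 : 0 <= K%:R * eta * e ^+ 2 by rewrite mulr_ge0// ltW.
lra.
Qed.

(** With r = |z(x) - x|, the subgradient term and the variation of phi are each at most L r, and 2 L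
    r <= rho / 2 r^2 + 2 L^2 / rho. *)
Let small_lipschitz K : L <= 2 * e -> e ^+ 2 <= rho * Del -> 4 * (eta * rho) <= 1 ->
  T <= K%:R ->
  (\sum_(k < K) mean_dist k.+1 <= (K%:R * (100 * e ^+ 2))%:E)%E.
Proof.
move=> Le big etarho TK.
have c0 : 0 <= 2 * L ^+ 2 / rho by rewrite divr_ge0 ?mulr_ge0 ?sqr_ge0// ltW.
apply: (@small_step K (fun _ _ => 2 * L ^+ 2 / rho)) => //.
- move=> k w; set z := prox_psi _ _ _ _ _.
  have := dotv_le (mean_vec D (g k (x k w) (y k w))) (z - x k w).
  have := ler_wpM2r (enorm_ge0 (z - x k w)) (gbar_le MP SP k (x k w) (y_dom MP SP k w)).
  have := le_trans (ler_norm _) (phi_lipschitz MP (x k w) z).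
  rewrite (enormB (x k w)); set r := enorm (z - x k w).
  have : 0 <= (rho * r - 2 * L) ^+ 2 / (2 * rho).
    by rewrite divr_ge0 ?sqr_ge0// mulr_ge0// ltW.
  have -> : (rho * r - 2 * L) ^+ 2 / (2 * rho) =
    rho / 2 * r ^+ 2 - 2 * L * r + 2 * L ^+ 2 / rho by field; rewrite gt_eqF.
  lra.
- under eq_bigr do rewrite integral_prob_cst.
  rewrite sum_EFin_const lee_fin ler_wpM2l// ler_pM2r ?invr_gt0//.
  have : L ^+ 2 <= (2 * e) ^+ 2 by rewrite ler_pXn2r// nnegrE// mulr_ge0// ltW.
  lra.
Qed.

Section LargeLipschitz.
Hypothesis Le : 2 * e < L.

Let Lp : 0 < L. Proof. by have := e0; have := Le; lra. Qed.
Let M0 : 0 < L * M.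
Proof. by rewrite mulr_gt0// ltr_pwDl// ltr_wpDr. Qed.

Let increments j k : (j <= k)%N ->
  (\int[P]_w (enorm (x k w - x j w))%:E <= ((k - j)%:R * (2 * eta * M))%:E)%E.
Proof.
have xm k' := (measurable_xy MP SP k').1.
have em k' j' : measurable_fun setT (fun w => enorm (x k' w - x j' w)).
  exact: measurable_fun_enormB.
move=> jk; rewrite -(subnK jk) addnK; elim: (k - j)%N => [|i IH].
  rewrite add0n mul0r; under eq_integral do rewrite subrr enorm0.
  by rewrite integral0.
apply: (@le_trans _ _ (\int[P]_w (enorm (x (i + j).+1 w - x (i + j)%N w)
    + enorm (x (i + j)%N w - x j w))%:E)%E).
  apply: integral_EFin_le => //.
  - exact: measurable_funD.
  - by move=> w; exact: enorm_ge0.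
  - by move=> w; exact: ler_distenormD.
rewrite integral_EFinD//; [|by move=> w; exact: enorm_ge0|by move=> w; exact: enorm_ge0].
rewrite -natr1 addrC mulrDl mul1r EFinD; apply: leeD => //.
exact: (mean_increment MP SP).
Qed.

(* Over a block of B steps the maximizer is frozen at the first x of the block. The
   distance to it telescopes to Dh^2 / (2 gam), and the drift of x costs at most
   B * 4 eta L M B; the two balance at B = e^2 / (rho eta L M). *)
Let block (alpha b : R) (B j : nat) : 0 < alpha -> alpha * Dh ^+ 2 <= e ^+ 2 / rho ->
  e ^+ 2 / (rho * eta * (L * M)) <= B%:R ->
  B%:R - 1 <= e ^+ 2 / (rho * eta * (L * M)) ->
  (\sum_(i < B) mean_gap (j + i).+1 <= (B%:R * (8 * e ^+ 2 / rho))%:E)%E.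
Proof.
move=> alpha0 alphaD BB BB1.
pose star := mean_dist_star Phi h P y0 gam x y alpha j.+1.
have H := @telescope_le _ (fun i => star (j + i)%N) (fun i => mean_gap (j + i).+1)
  (fun i => (alpha * Dh ^+ 2 + gam * sigma ^+ 2)%:E +
     (2 * L)%:E * \int[P]_w (enorm (x (j + i).+1 w - x j.+1 w))%:E)%E B.
have g20 : 0 <= (2 * gam)^-1 by rewrite invr_ge0 mulr_ge0// ltW.
have star0 i : (0 <= star i)%E.
  by apply: integral_EFin_ge0 => w; rewrite mulr_ge0 ?sqr_ge0.
apply: (@le_trans _ _ (star (j + B)%N + \sum_(i < B) mean_gap (j + i).+1)%E).
  by rewrite leeDr.
apply: (le_trans (H _)).
  move=> i _; have ji : (j.+1 <= (j + i).+1)%N by rewrite ltnS leq_addr.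
  have := mean_gap_step MP SP alpha0 ji.
  by rewrite (addeC (mean_gap _)) addnS.
rewrite addn0; have Mp : 0 < M by rewrite -(pmulr_rgt0 _ Lp).
have M00 := ltW Mp.
have c0 : 0 <= 4 * eta * (L * M) by rewrite mulr_ge0 ?(ltW M0)// mulr_ge0// ltW.
(* Within a block x drifts for at most B - 1 steps, so rounding the block length up does not
   increase the drift bound. *)
apply: (@le_trans _ _ ((Dh ^+ 2 / (2 * gam))%:E +
  \sum_(i < B) (alpha * Dh ^+ 2 + gam * sigma ^+ 2
     + 4 * eta * (L * M) * (B%:R - 1))%:E)%E).
  apply: leeD; first exact: (mean_dist_star_le MP SP _ alpha0).
  apply: lee_sum => i _; rewrite [leRHS]EFinD leeD2l//.
  apply: (@le_trans _ _ ((2 * L)%:E * ((i : nat)%:R * (2 * eta * M))%:E)%E).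
    rewrite lee_pmul2l ?fin_numE// ?lte_fin ?mulr_gt0//.
    by have := @increments j.+1 (j + i).+1; rewrite subSS addKn; apply; rewrite ltnS leq_addr.
  rewrite -EFinM lee_fin.
  have -> : 2 * L * (i%:R * (2 * eta * M)) = 4 * eta * (L * M) * i%:R by ring.
  by rewrite ler_wpM2l// lerBrDr natr1 ler_nat.
rewrite sum_EFin_const -EFinD lee_fin.
have B1 : 0 <= (B%:R : R) by [].
have reM : 0 < rho * eta * (L * M) by rewrite mulr_gt0// mulr_gt0.
(* Budget per step in units of e^2 / rho: 1 for the smoothing, 1 for the noise, 4 for the drift and
   3/2 for the telescoped distance, below the allowed 8. *)
have H1 : gam * sigma ^+ 2 <= e ^+ 2 / rho.
  by rewrite ler_pdivlMr// mulrAC.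
have H2 : 4 * eta * (L * M) * (B%:R - 1) <= 4 * (e ^+ 2 / rho).
  move: BB1; rewrite ler_pdivlMr// => BB1.
  by rewrite [leRHS]mulrA ler_pdivlMr//; lra.
have H3 : Dh ^+ 2 / (2 * gam) <= B%:R * (3 / 2 * (e ^+ 2 / rho)).
  have : e ^+ 2 / (rho * eta * (L * M)) * (3 / 2 * (e ^+ 2 / rho)) <=
     B%:R * (3 / 2 * (e ^+ 2 / rho)).
    by rewrite ler_wpM2r// mulr_ge0// divr_ge0// ltW.
  apply: le_trans.
  have -> : e ^+ 2 / (rho * eta * (L * M)) * (3 / 2 * (e ^+ 2 / rho)) =
    3 * e ^+ 4 / (2 * (eta * rho ^+ 2 * (L * M))).
    by move: (L * M) M0 => q q0; field; rewrite !gt_eqF.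
  rewrite ler_pdivrMr ?mulr_gt0// mulrAC ler_pdivlMr ?mulr_gt0 ?exprn_gt0//.
  have := eta_gam_le; lra.
have : B%:R * (alpha * Dh ^+ 2 + gam * sigma ^+ 2 + 4 * eta * (L * M) * (B%:R - 1))
   <= B%:R * (6 * (e ^+ 2 / rho)) by rewrite ler_wpM2l//; lra.
have : 0 <= B%:R * (e ^+ 2 / rho) by rewrite mulr_ge0// divr_ge0// ltW.
lra.
Qed.

Lemma stationary_average_large_lipschitz : e ^+ 2 <= rho * Del -> exists K : nat,
  [/\ (0 < K)%N, K%:R <= 2 * T + 1 &
   (\sum_(k < K) mean_dist k.+1 <= (K%:R * (100 * e ^+ 2))%:E)%E].
Proof.
move=> big.
have LL : (2 * e) ^+ 2 < L ^+ 2 by rewrite ltr_pXn2r// nnegrE ?(ltW Lp)// mulr_ge0// ltW.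
have LM : 4 * e ^+ 2 <= L * M.
  have : L * L <= L * M by rewrite ler_pM2l// -addrA lerDl addr_ge0.
  lra.
have er0 : 0 < eta * rho by rewrite mulr_gt0.
have etarho : 4 * (eta * rho) <= 1.
  have : eta * rho * (4 * e ^+ 2) <= 1 * e ^+ 2.
    apply: le_trans (_ : eta * rho * (L ^+ 2 + sigma ^+ 2) <= _); last by have := eta_le; lra.
    by rewrite ler_pM2l//; have := sqr_ge0 sigma; lra.
  by rewrite mulrA ler_pM2r// mulrC.
(* The summand 1 keeps alpha defined and positive when Dh = 0. *)
pose alpha := e ^+ 2 / (rho * (Dh ^+ 2 + 1)).
have D0 : 0 < Dh ^+ 2 + 1 by rewrite ltr_wpDl// sqr_ge0.
have alpha0 : 0 < alpha by rewrite divr_gt0// mulr_gt0.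
have alphaD : alpha * Dh ^+ 2 <= e ^+ 2 / rho.
  have -> : alpha * Dh ^+ 2 = e ^+ 2 / rho * (Dh ^+ 2 / (Dh ^+ 2 + 1)).
    by rewrite /alpha; field; rewrite !gt_eqF.
  rewrite ler_piMr//; first by rewrite divr_ge0// ltW.
  by rewrite ler_pdivrMr// mul1r lerDl.
pose B0 := e ^+ 2 / (rho * eta * (L * M)).
have reM : 0 < rho * eta * (L * M) by rewrite mulr_gt0// mulr_gt0.
have B00 : 0 <= B0 by rewrite divr_ge0 ?ltW.
(* L > 2 e gives e^2 <= L M, so rho B0 eta e^2 = e^4 / (L M) <= e^2 <= rho Del. *)
have B0T : B0 <= T.
  have : B0 * (eta * e ^+ 2) <= T * (eta * e ^+ 2).
    rewrite -DelE -(ler_pM2l rho0).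
    have -> : rho * (B0 * (eta * e ^+ 2)) = e ^+ 2 * (e ^+ 2 / (L * M)).
      by rewrite /B0; move: (L * M) M0 => q q0; field; rewrite !gt_eqF.
    apply: le_trans big; rewrite ger_pMr// ler_pdivrMr// mul1r.
    by have := e20; lra.
  by rewrite ler_pM2r// mulr_gt0.
have [b /andP[bB0 B0b]] := floor_nat B00.
(* K consists of q + 1 whole blocks of length b + 1. It exceeds T by at most one block, and b <= B0
   <= T gives K <= 2 T + 1. *)
have [q /andP[qT Tq]] := floor_nat (divr_ge0 T0 (ler0n _ b.+1)).
have b0 : 0 < (b.+1%:R : R) by [].
exists (q.+1 * b.+1)%N; split => //.
- rewrite natrM -natr1 mulrDl mul1r.
  have : q%:R * b.+1%:R <= T by rewrite -ler_pdivlMr.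
  have : (b.+1%:R : R) = b%:R + 1 by rewrite natr1.
  lra.
apply: (@small_step _ (fun k w => gap Phi h (x k w) (y k w))) => //.
- by rewrite natrM -ler_pdivrMr// ltW.
- move=> k; have [xm ym] := measurable_xy MP SP k.
  by apply: (measurable_gap MP) => // w; exact: (y_dom MP SP).
- by move=> k w; apply: (gap_ge0 MP); exact: (y_dom MP SP).
- move=> k w; set z := prox_psi _ _ _ _ _.
  have := gbar_subgradient MP SP k (x k w) (y k w) z.
  have := phi_ge MP z (y_dom MP SP k w).
  by rewrite /gap; lra.
have bl j : (\sum_(i < b.+1) mean_gap (j + i).+1 <= (b.+1%:R * (8 * e ^+ 2 / rho))%:E)%E.
  by apply: (@block alpha 0 b.+1 j alpha0 alphaD); [exact: ltW|rewrite -natr1 addrK].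
elim: (q.+1) => [|q' IH]; first by rewrite mul0n big_ord0 mul0r.
rewrite mulSn addnC big_split_ord/= natrD mulrDl EFinD; apply: leeD; first exact: IH.
exact: bl.
Qed.

End LargeLipschitz.

Lemma stationary_average : exists K : nat,
  [/\ (0 < K)%N, K%:R <= 2 * T + 1 &
   (\sum_(k < K) mean_dist k.+1 <= (K%:R * (100 * e ^+ 2))%:E)%E].
Proof.
have [small|/ltW big] := leP (rho * Del) (e ^+ 2).
  exists 1%N; split => //; first by rewrite lerDr mulr_ge0.
  by rewrite big_ord1 mul1r; exact: near_minimizer.
have [Le|Le] := leP L (2 * e); last exact: stationary_average_large_lipschitz.
have [k /andP[kT Tk]] := floor_nat T0.
exists k.+1; split => //.
  by rewrite -natr1 lerD2r (le_trans kT)//; have := T0; lra.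
have [etarho|/ltW etarho] := leP (4 * (eta * rho)) 1.
  by apply: small_lipschitz => //; exact: ltW.
by apply: large_step => //; exact: ltW.
Qed.

End Complexity.

(** * Step sizes *)

Section StepSizeBounds.
Context {R : realType}.
Implicit Types a b s e rho L Lf Lphi Dh sigma : R.

Lemma le_frac s a b : 0 <= a -> 0 <= b -> (s%:E <= Defs.frac a b)%E -> s * b <= a.
Proof.
move=> a0 b0; rewrite /Defs.frac; case: eqP => [->|/eqP bn]; first by rewrite mulr0.
have bp : 0 < b by rewrite lt_def bn.
by rewrite lee_fin ler_pdivlMr.
Qed.

(** A step size that is a real number rules out the zero denominator, read as [+oo]. *)
Lemma eq_frac s a b : 0 < a -> 0 <= b -> s%:E = Defs.frac a b -> 0 < s /\ s * b = a.
Proof.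
move=> a0 b0; rewrite /Defs.frac; case: eqP => // /eqP bn [->].
have bp : 0 < b by rewrite lt_def bn.
by rewrite divr_gt0// divfK.
Qed.

(** The last conjunct is the lower bound on the step: the fraction attaining the minimum gives an
    equality, and the other denominator only adds a nonnegative term. Written without division, it
    stays valid for zero denominators. [stepxP] follows the same pattern. *)
Lemma stepyP gam e rho Lphi sigma : 0 < e -> 0 < rho -> 0 <= Lphi ->
  gam%:E = stepy e rho Lphi sigma ->
  [/\ 0 < gam, 2 * gam * Lphi <= 1, gam * rho * sigma ^+ 2 <= e ^+ 2 &
   e ^+ 2 <= gam * (2 * Lphi * e ^+ 2 + rho * sigma ^+ 2)].
Proof.
move=> e0 rho0 L0 gE.
have e20 : 0 < e ^+ 2 by rewrite exprn_gt0.
have b1 : 0 <= 2 * Lphi by rewrite mulr_ge0.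
have b2 : 0 <= rho * sigma ^+ 2 by rewrite mulr_ge0 ?sqr_ge0// ltW.
have H1 : gam * (2 * Lphi) <= 1.
  by apply: le_frac => //; rewrite gE /stepy ge_min lexx.
have H2 : gam * (rho * sigma ^+ 2) <= e ^+ 2.
  by apply: le_frac => //; [exact: ltW|rewrite gE /stepy ge_min lexx orbT].
have [g0 H] : 0 < gam /\ e ^+ 2 <= gam * (2 * Lphi * e ^+ 2 + rho * sigma ^+ 2).
  move: gE; rewrite /stepy minEle; case: ifP => _ /eq_frac[]// g0 gE; split => //.
    have := mulr_ge0 (ltW g0) b2.
    have : gam * (2 * Lphi) * e ^+ 2 = e ^+ 2 by rewrite gE mul1r.
    lra.
  have := mulr_ge0 (mulr_ge0 (ltW g0) b1) (ltW e20); lra.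
by split => //; lra.
Qed.

Lemma stepxP eta e rho L Lf Lphi Dh sigma :
  0 < e -> 0 < rho -> 0 <= L -> 0 <= Lf -> 0 <= Lphi -> 0 <= sigma ->
  eta%:E = stepx e rho L Lf Lphi Dh sigma ->
  [/\ 0 < eta, eta * rho * (L ^+ 2 + sigma ^+ 2) <= e ^+ 2,
   eta * (rho ^+ 2 * L * (L + Lf + sigma) * Dh ^+ 2 * Lphi) <= e ^+ 4,
   eta * (rho ^+ 3 * L * (L + Lf + sigma) * sigma ^+ 2 * Dh ^+ 2) <= e ^+ 6 &
   e ^+ 6 <= eta * (rho * (L ^+ 2 + sigma ^+ 2) * e ^+ 4
     + rho ^+ 2 * L * (L + Lf + sigma) * Dh ^+ 2 * Lphi * e ^+ 2
     + rho ^+ 3 * L * (L + Lf + sigma) * sigma ^+ 2 * Dh ^+ 2)].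
Proof.
move=> e0 rho0 L0 Lf0 Lp0 s0 etaE.
set b1 := rho * (L ^+ 2 + sigma ^+ 2).
set b2 := rho ^+ 2 * L * (L + Lf + sigma) * Dh ^+ 2 * Lphi.
set b3 := rho ^+ 3 * L * (L + Lf + sigma) * sigma ^+ 2 * Dh ^+ 2.
have b10 : 0 <= b1 by rewrite mulr_ge0 ?addr_ge0 ?sqr_ge0// ltW.
have M0 : 0 <= L + Lf + sigma by rewrite !addr_ge0.
have b20 : 0 <= b2.
  by rewrite /b2 (mulr_ge0 _ Lp0)// mulr_ge0 ?sqr_ge0// (mulr_ge0 _ M0)// mulr_ge0// sqr_ge0.
have b30 : 0 <= b3.
  rewrite /b3 mulr_ge0 ?sqr_ge0// mulr_ge0 ?sqr_ge0// (mulr_ge0 _ M0)// mulr_ge0//.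
  by rewrite exprn_ge0// ltW.
have ep k : 0 < e ^+ k by rewrite exprn_gt0.
have H1 : eta * b1 <= e ^+ 2.
  by apply: le_frac; rewrite ?(ltW (ep _))// etaE /stepx ge_min lexx.
have H2 : eta * b2 <= e ^+ 4.
  by apply: le_frac; rewrite ?(ltW (ep _))// etaE /stepx !ge_min lexx orbT.
have H3 : eta * b3 <= e ^+ 6.
  by apply: le_frac; rewrite ?(ltW (ep _))// etaE /stepx !ge_min lexx !orbT.
have [eta0 H] : 0 < eta /\ e ^+ 6 <= eta * (b1 * e ^+ 4 + b2 * e ^+ 2 + b3).
  have T1 : 0 <= b1 * e ^+ 4 by rewrite mulr_ge0// ltW.
  have T2 : 0 <= b2 * e ^+ 2 by rewrite mulr_ge0// ltW.
  move: etaE; rewrite /stepx minEle; case: ifP => _.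
    move=> /eq_frac[]// g0 gE; split => //.
    have := mulr_ge0 (ltW g0) (addr_ge0 T2 b30).
    have : eta * b1 * e ^+ 4 = e ^+ 6 by rewrite gE -exprD.
    lra.
  rewrite minEle; case: ifP => _ /eq_frac[]// g0 gE; split => //.
    have := mulr_ge0 (ltW g0) (addr_ge0 T1 b30).
    have : eta * b2 * e ^+ 2 = e ^+ 6 by rewrite gE -exprD.
    lra.
  have : eta * b3 = e ^+ 6 by [].
  have := mulr_ge0 (ltW g0) (addr_ge0 T1 T2); lra.
by split => //; rewrite -mulrA.
Qed.

(** One kappa^4 comes from e^4 against eps^4 in the prefactor, another from the maximum, whence
    kappa^8 <= 20^8. The 10 is the 2 on the left times the 1 + 2 + 2 terms of [J]. *)
Lemma complexity_bound eta e kappa Del rho L Lf Lphi Dh sigma :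
  0 < e -> 1 <= kappa <= 20 -> 0 <= Del -> 0 < rho -> 0 <= L -> 0 <= Lf ->
  0 <= Lphi -> 0 <= sigma ->
  0 < eta ->
  e ^+ 6 <= eta * (rho * (L ^+ 2 + sigma ^+ 2) * e ^+ 4
     + rho ^+ 2 * L * (L + Lf + sigma) * Dh ^+ 2 * Lphi * e ^+ 2
     + rho ^+ 3 * L * (L + Lf + sigma) * sigma ^+ 2 * Dh ^+ 2) ->
  2 * (Del / (eta * e ^+ 2)) <= 10 * 20 ^+ 8 *
    (Del * ((L ^+ 2 + Lf ^+ 2 + sigma ^+ 2) * rho / (kappa * e) ^+ 4) *
     Num.max 1 (Num.max (rho * Lphi * Dh ^+ 2 / (kappa * e) ^+ 2)
                        (rho ^+ 2 * Dh ^+ 2 * sigma ^+ 2 / (kappa * e) ^+ 4))).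
Proof.
move=> e0 /andP[k1 k20] D0 rho0 L0 Lf0 Lp0 s0 eta0 He.
have k0 : 0 < kappa by lra.
set N := L ^+ 2 + Lf ^+ 2 + sigma ^+ 2.
set p := rho * Lphi * Dh ^+ 2 / (kappa * e) ^+ 2.
set q := rho ^+ 2 * Dh ^+ 2 * sigma ^+ 2 / (kappa * e) ^+ 4.
set Mx := Num.max _ _.
have M1 : 1 <= Mx by rewrite /Mx le_max lexx.
have Mp : p <= Mx by rewrite /Mx !le_max lexx orbT.
have Mq : q <= Mx by rewrite /Mx !le_max lexx !orbT.
have p0 : 0 <= p.
  by rewrite divr_ge0 ?sqr_ge0// mulr_ge0 ?sqr_ge0// mulr_ge0// ltW.
have q0 : 0 <= q.
  apply: divr_ge0; last by rewrite exprn_ge0// mulr_ge0 ?(ltW k0)// ltW.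
  by rewrite mulr_ge0 ?sqr_ge0// mulr_ge0 ?sqr_ge0.
have N20 : 0 <= N by rewrite !addr_ge0// sqr_ge0.
have NL : L * (L + Lf + sigma) <= 2 * N.
  by have := sqr_ge0 (L - Lf); have := sqr_ge0 (L - sigma);
     have := sqr_ge0 Lf; have := sqr_ge0 sigma; rewrite /N; lra.
have NL2 : L ^+ 2 + sigma ^+ 2 <= N by have := sqr_ge0 Lf; rewrite /N; lra.
have pE : rho * Lphi * Dh ^+ 2 = p * (kappa ^+ 2 * e ^+ 2).
  by rewrite -(exprMn 2 kappa e) /p divfK// gt_eqF// exprn_gt0// mulr_gt0.
have qE : rho ^+ 2 * Dh ^+ 2 * sigma ^+ 2 = q * (kappa ^+ 4 * e ^+ 4).
  by rewrite -(exprMn 4 kappa e) /q divfK// gt_eqF// exprn_gt0// mulr_gt0.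
pose J := 1 + 2 * p * kappa ^+ 2 + 2 * q * kappa ^+ 4.
have J1 : e ^+ 6 <= eta * (rho * N * e ^+ 4 * J).
  apply: (le_trans He); rewrite ler_pM2l//.
  have -> : rho ^+ 2 * L * (L + Lf + sigma) * Dh ^+ 2 * Lphi * e ^+ 2 =
    rho * (L * (L + Lf + sigma)) * (rho * Lphi * Dh ^+ 2) * e ^+ 2 by ring.
  have -> : rho ^+ 3 * L * (L + Lf + sigma) * sigma ^+ 2 * Dh ^+ 2 =
    rho * (L * (L + Lf + sigma)) * (rho ^+ 2 * Dh ^+ 2 * sigma ^+ 2) by ring.
  rewrite pE qE.
  have re : 0 <= rho * e ^+ 4 by rewrite mulr_ge0 ?exprn_ge0// ltW.
  have H1 := ler_wpM2l re NL2.
  have rp : 0 <= rho * e ^+ 4 * (p * kappa ^+ 2) by rewrite mulr_ge0// mulr_ge0// sqr_ge0.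
  have rq : 0 <= rho * e ^+ 4 * (q * kappa ^+ 4).
    exact: mulr_ge0 re (mulr_ge0 q0 (exprn_ge0 4 (ltW k0))).
  have H2 := ler_wpM2l rp NL.
  have H3 := ler_wpM2l rq NL.
  rewrite /J; lra.
have kk k : 1 <= kappa ^+ k by rewrite exprn_ege1.
have J2 : J <= 5 * (kappa ^+ 4 * Mx).
  have kM : 0 <= kappa ^+ 4 * Mx by rewrite mulr_ge0// (le_trans ler01).
  have H1 : 1 * 1 <= kappa ^+ 4 * Mx by rewrite ler_pM.
  have H2 : p * kappa ^+ 2 <= Mx * kappa ^+ 4.
    by rewrite ler_pM ?sqr_ge0//; rewrite ler_weXn2l.
  have H3 : q * kappa ^+ 4 <= Mx * kappa ^+ 4.
    by rewrite ler_wpM2r// (le_trans ler01).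
  rewrite /J; lra.
have e6 : 0 < e ^+ 6 by rewrite exprn_gt0.
have e4 : 0 < e ^+ 4 by rewrite exprn_gt0.
have lhs : Del / (eta * e ^+ 2) <= Del * (rho * N / e ^+ 4) * J.
  rewrite ler_pdivrMr ?mulr_gt0 ?exprn_gt0//.
  have -> : Del * (rho * N / e ^+ 4) * J * (eta * e ^+ 2) =
    Del * ((eta * (rho * N * e ^+ 4 * J)) / e ^+ 6) by field; rewrite gt_eqF.
  by rewrite ler_peMr// ler_pdivlMr// mul1r.
have D1 : 0 <= Del * (rho * N / e ^+ 4).
  by rewrite mulr_ge0// divr_ge0 ?(ltW e4)// mulr_ge0// ltW.
have DE : Del * (rho * N / e ^+ 4) = kappa ^+ 4 * (Del * (N * rho / (kappa * e) ^+ 4)).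
  by field; rewrite !gt_eqF.
set X := Del * (N * rho / (kappa * e) ^+ 4) in DE *.
have X0 : 0 <= X.
  have : 0 < kappa ^+ 4 by rewrite exprn_gt0.
  by move=> k4; rewrite -(pmulr_rge0 _ k4) -DE.
have k8 : kappa ^+ 8 <= 20 ^+ 8 by rewrite ler_pXn2r// nnegrE ltW.
have XM : 0 <= X * Mx by rewrite mulr_ge0// (le_trans ler01).
have H1 := ler_wpM2l D1 J2.
have H2 := ler_wpM2r XM k8.
have H3 : Del * (rho * N / e ^+ 4) * (5 * (kappa ^+ 4 * Mx)) = 5 * (kappa ^+ 8 * (X * Mx)).
  by rewrite DE; ring.
rewrite H3 in H1.
rewrite -[leRHS]mulrA; move: (20 ^+ 8 * (X * Mx)) H2 => Z; lra.
Qed.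

End StepSizeBounds.

(** * From the average over the steps to one stationary iterate *)

Lemma pigeonhole_sum {R : realType} (a : nat -> \bar R) (c : R) K : (0 < K)%N ->
  (\sum_(k < K) a k.+1 <= (K%:R * c)%:E)%E -> exists2 k, (k < K)%N & (a k.+1 <= c%:E)%E.
Proof.
move=> K0 H; apply: contrapT => /forall2NP N.
have lt k : (k < K)%N -> (c%:E < a k.+1)%E.
  by move=> kK; case: (N k) => // /negP; rewrite -ltNge.
have : ((K%:R * c)%:E < \sum_(k < K) a k.+1)%E; last by rewrite ltNge H.
rewrite -sum_EFin_const; case: K K0 {H N} lt => // K _; elim: K => [|K IH] lt.
  by rewrite !big_ord1; exact: lt.
rewrite big_ord_recr [ltRHS]big_ord_recr/=; apply: lteD; last exact: lt.
by apply: IH => k kK; apply: lt; exact: ltnW.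
Qed.

(** Integrate X <= X^2 / (2 c) + c / 2. *)
Lemma mean_le_of_mean_square {R : realType} {dT} {T : measurableType dT} (P : probability T R)
    (X : T -> R) (c : R) : 0 < c -> measurable_fun setT X -> (forall w, 0 <= X w) ->
  (\int[P]_w (X w ^+ 2)%:E <= (c ^+ 2)%:E)%E -> (\int[P]_w (X w)%:E <= c%:E)%E.
Proof.
move=> c0 Xm X0 H; have c20 : 0 < 2 * c by rewrite mulr_gt0.
have X2m : measurable_fun setT (fun w => X w ^+ 2) by exact: measurable_funX.
have i0 : 0 <= (2 * c)^-1 by rewrite invr_ge0 ltW.
apply: (@le_trans _ _ (\int[P]_w ((2 * c)^-1 * X w ^+ 2 + c / 2)%:E)%E).
  apply: integral_EFin_le => //.
    by apply: measurable_funD => //; exact: measurable_funM.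
  move=> w; have : 0 <= (2 * c)^-1 * (X w - c) ^+ 2 by rewrite mulr_ge0// sqr_ge0.
  have -> : (2 * c)^-1 * (X w - c) ^+ 2 = (2 * c)^-1 * X w ^+ 2 - X w + c / 2.
    by field; rewrite gt_eqF.
  lra.
rewrite integral_EFinD//; [|exact: measurable_funM|by move=> w; rewrite mulr_ge0// sqr_ge0|
  by move=> w; rewrite divr_ge0// ltW].
rewrite integral_EFinZ//; last by move=> w; exact: sqr_ge0.
rewrite integral_prob_cst.
apply: (@le_trans _ _ ((2 * c)^-1%:E * (c ^+ 2)%:E + (c / 2)%:E)%E).
  by rewrite leeD2r// lee_wpmul2l.
rewrite -EFinM -EFinD lee_fin.
by have -> : (2 * c)^-1 * c ^+ 2 + c / 2 = c by field; rewrite gt_eqF.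
Qed.

Lemma lipschitz_on_indicator {R : realType} d (S : set 'rV[R]_d) Lf : 0 <= Lf ->
  lipschitz_on_dom Lf (indicator_fun S).
Proof.
move=> L0 x x'; rewrite /dom /indicator_fun /=.
case: ifP => // _ _; case: ifP => // _ _.
by rewrite subee// abse0 lee_fin mulr_ge0// enorm_ge0.
Qed.

(* A and C are the absolute constants. For the unscaled step sizes (kappa = 1)
   the accuracy is A * eps; for kappa = A, i.e. with eps / A in place of eps in the
   step sizes, it is exactly eps. Having both at kappa = 1 is impossible. Take d
   large, sigma >> eps, f = 0, h the indicator of {0} in R^1,
   Phi(x, y; xi) = w(|x|) + <xi, x> with w(r) = b r - rho r^2 / 2 for r <= b / rho
   and w constant beyond, b = 1.45 eps, xi uniform on {- sigma / sqrt d, sigma / sqrt d}^d,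
   and |x0| = 0.563 eps / rho: then E|grad psi_lambda(x_k)| stays close to 1.13 eps
   for as many steps as wanted.
   The summand 1 in the bound on K is needed since the minimum starts at k = 1,
   while the complexity expression may be arbitrarily small. *)
Theorem theorem3p2 (R : realType) :
  exists A C : R, [/\ 1 <= A, 0 < C &
  forall (d n : nat) (Phi : 'rV[R]_d -> 'rV[R]_n -> R)
    (f : 'rV[R]_d -> \bar R) (h : 'rV[R]_n -> \bar R)
    (rho L Lf Lphi Dh sigma eps kappa : R)
    (dX : measure_display) (Xi : measurableType dX) (D : probability Xi R)
    (Phis : 'rV[R]_d -> 'rV[R]_n -> Xi -> R)
    (g : nat -> 'rV[R]_d -> 'rV[R]_n -> Xi -> 'rV[R]_d)
    (dO : measure_display) (Omega : measurableType dO) (P : probability Omega R)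
    (xi zeta : nat -> {RV P >-> Xi})
    (x0 : 'rV[R]_d) (y0 : 'rV[R]_n) (eta_x eta_y : R)
    (x : nat -> Omega -> 'rV[R]_d) (y : nat -> Omega -> 'rV[R]_n),
  0 < rho -> 0 <= L -> 0 <= Lf -> 0 <= Lphi -> 0 <= Dh -> 0 <= sigma ->
  0 < eps -> 1 <= kappa <= A ->
  (forall u, @convex_function R 'rV[R]_n setT (fun v => - Phi u v)) ->
  (forall u v, differentiable (Phi u) v) ->
  (forall u v v',
     enorm (grad (Phi u) v - grad (Phi u) v') <= Lphi * enorm (v - v')) ->
  (forall v, @convex_function R 'rV[R]_d setT
     (fun u => Phi u v + rho / 2 * enorm u ^+ 2)) ->
  (forall u u' v, dom h v -> `|Phi u v - Phi u' v| <= L * enorm (u - u')) ->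
  proper_lsc_convex f -> proper_lsc_convex h ->
  (open (dom f) /\ lipschitz_on_dom Lf f) \/
    (exists S : set 'rV[R]_d, [/\ S !=set0, closed S,
       @convex_set R 'rV[R]_d S & f = indicator_fun S]) ->
  (forall v v', dom h v -> dom h v' -> enorm (v - v') <= Dh) ->
  (-oo < ereal_inf (range (primal Phi f h)))%E ->
  (forall u v, D.-integrable setT (fun s => (Phis u v s)%:E) /\
     (Phi u v)%:E = 'E_D[Phis u v]%E) ->
  (forall u v s, differentiable (fun v' => Phis u v' s) v) ->
  joint_measurable (fun u v s => grad (fun v' => Phis u v' s) v) ->
  (forall u v, let G := fun s => grad (fun v' => Phis u v' s) v in
     [/\ integrable_vec D G, mean_vec D G = grad (Phi u) v &
         (mean_sqdist D G (grad (Phi u) v) <= (sigma ^+ 2)%:E)%E]) ->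
  (forall k, joint_measurable (g k)) ->
  (forall k u v s,
     frechet_subdiff (fun u' => (Phis u' v s)%:E) u (g k u v s)) ->
  (forall k u v,
     [/\ integrable_vec D (g k u v),
         frechet_subdiff (fun u' => (Phi u' v)%:E) u (mean_vec D (g k u v)) &
         (mean_sqdist D (g k u v) (mean_vec D (g k u v))
            <= (sigma ^+ 2)%:E)%E]) ->
  dom f x0 -> dom h y0 ->
  eta_x%:E = stepx (eps / kappa) rho L Lf Lphi Dh sigma ->
  eta_y%:E = stepy (eps / kappa) rho Lphi sigma ->
  (forall w, x 0%N w = x0) -> (forall w, y 0%N w = y0) ->
  (forall k w, x k.+1 w =
     prox eta_x f (x k w - eta_x *: g k (x k w) (y k w) (xi k w))) ->
  (forall k w, y k.+1 w =
     prox eta_y h (y k w + eta_y *: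
       grad (fun v => Phis (x k.+1 w) v (zeta k w)) (y k w))) ->
  (forall k B, measurable B -> distribution P (xi k) B = D B) ->
  (forall k B, measurable B -> distribution P (zeta k) B = D B) ->
  (forall k, independent_of P (xi k) (history x y k k)) ->
  (forall k, independent_of P (zeta k) (history x y k.+1 k)) ->
  exists K : nat,
    ((K%:R)%:E <= C%:E * complexity
        (primal Phi f h x0 - ereal_inf (range (primal Phi f h)))
        (primal Phi f h x0 - saddle Phi f h x0 y0)
        eps rho L Lf Lphi Dh sigma + 1)%E /\
    (\big[Order.min/+oo]_(1 <= k < K.+1)
        'E_P[fun w => enorm (grad_moreau (1 / (2 * rho))%R (primal Phi f h) (x k w))]
      <= (A / kappa * eps)%:E)%E].
Proof.
exists 20, (10 * 20 ^+ 8); split; [by rewrite ler1n|by rewrite mulr_gt0|].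
move=> d n Phi f h rho L Lf Lphi Dh sigma eps kappa dX Xi D Phis g dO Omega P xi zeta
  x0 y0 eta_x eta_y x y rho0 L0 Lf0 Lphi0 Dh0 sigma0 eps0 kappa12 Phi_conc Phi_diff
  Phi_sm Phi_weak Phi_lip f_conv h_conv f_struct h_diam psi_lb _ _ G_meas G_mean g_meas
  _ g_mean fx0 hy0 eta_xE eta_yE x_0 y_0 x_S y_S xi_D zeta_D xi_ind zeta_ind.
have [k1 k20] := andP kappa12; have k0 : 0 < kappa by apply: lt_le_trans k1.
pose e := eps / kappa; have e0 : 0 < e by rewrite divr_gt0.
have epsE : eps = kappa * e by rewrite /e mulrC divfK// gt_eqF.
rewrite -/e in eta_xE eta_yE.
have [ex0 eN eDL eDs eC] := stepxP e0 rho0 L0 Lf0 Lphi0 sigma0 eta_xE.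
have [ey0 eyL eys eyC] := stepyP e0 rho0 Lphi0 eta_yE.
have MP : minimax_problem Phi f h rho L Lf Lphi Dh.
  split => //.
  - by move=> u; exact: convex_function_mod_convex.
  - move=> v; have := mod_convexD (convex_function_mod_convex (Phi_weak v))
      (@mod_convex_sqdist _ _ (- (rho / 2)) 0).
    have -> : 0 + 2 * - (rho / 2) = - rho by field.
    by congr mod_convex; apply/funext => u; rewrite subr0 mulNr addrK.
  - by case: f_struct => [[]//|[S [_ _ _ ->]]]; exact: lipschitz_on_indicator.
pose G u v s := grad (fun v' => Phis u v' s) v.
have SP : stochastic_gda Phi f h Lphi sigma D g G xi zeta x0 y0 eta_x eta_y x y by [].
have primal0 := primal_psiE MP fx0.
pose m := fine (ereal_inf (range (primal Phi f h))).
have mE : m%:E = ereal_inf (range (primal Phi f h)).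
  rewrite fineK// fin_numElt psi_lb /=.
  by apply: (@le_lt_trans _ _ (primal Phi f h x0));
    [apply: ereal_inf_lbound; exists x0|rewrite primal0 ltry].
have psi_ge u : dom f u -> m <= psi Phi f h u.
  move=> fu; rewrite -lee_fin mE -(primal_psiE MP fu).
  by apply: ereal_inf_lbound; exists u.
have M0 : 0 <= L + Lf + sigma by rewrite !addr_ge0.
have e20 : 0 < e ^+ 2 by rewrite exprn_gt0.
(* The lower bound on eta_y has the terms 2 Lphi e^2 and rho sigma^2; the second and third entries
   of eta_x turn them into 2 e^6 and e^6, whence the 3. *)
have eta_gam : eta_x * rho ^+ 2 * (L * (L + Lf + sigma)) * Dh ^+ 2 <= 3 * e ^+ 4 * eta_y.
  set c := eta_x * _ * _ * _.
  have c0 : 0 <= c.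
    by rewrite mulr_ge0 ?sqr_ge0// mulr_ge0 ?(mulr_ge0 L0)// mulr_ge0 ?sqr_ge0// ltW.
  have c1 : c * Lphi <= e ^+ 4 by apply: le_trans eDL; rewrite /c; lra.
  have c2 : c * (rho * sigma ^+ 2) <= e ^+ 6 by apply: le_trans eDs; rewrite /c; lra.
  have H1 := ler_wpM2l c0 eyC.
  have H2 := ler_wpM2l (ltW ey0) c2.
  have H3 : eta_y * e ^+ 2 * (c * Lphi) <= eta_y * e ^+ 2 * e ^+ 4.
    by rewrite ler_wpM2l// mulr_ge0// ltW.
  by rewrite -(ler_pM2r e20); lra.
have [K [K0 KT Ksum]] := stationary_average MP SP psi_ge e0 eN eta_gam eys.
exists K; split.
- rewrite -mE /complexity primal0.
  have gap0 := gap_ge0 MP x0 hy0.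
  (* So Delta_0 is the gap at the starting point, hence nonnegative. *)
  have -> : saddle Phi f h x0 y0 = (psi Phi f h x0 - gap Phi h x0 y0)%:E.
    rewrite /saddle -(dom_fineK f_conv fx0) -(dom_fineK h_conv hy0).
    transitivity (fine (f x0) + Phi x0 y0 - fine (h y0))%:E => //.
    by rewrite /gap /psi; congr EFin; ring.
  suff : K%:R <= 10 * 20 ^+ 8 * ((psi Phi f h x0 - m)
        * ((L ^+ 2 + Lf ^+ 2 + sigma ^+ 2) * rho / eps ^+ 4)
        * Num.max 1 (Num.max (rho * Lphi * Dh ^+ 2 / eps ^+ 2)
                       (rho ^+ 2 * Dh ^+ 2 * sigma ^+ 2 / eps ^+ 4))
      + (psi Phi f h x0 - (psi Phi f h x0 - gap Phi h x0 y0)) * (rho / eps ^+ 2)) + 1.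
    by rewrite -lee_fin.
  have Del0 : 0 <= psi Phi f h x0 - m by rewrite subr_ge0 psi_ge.
  have := @complexity_bound _ eta_x e kappa _ rho L Lf Lphi Dh sigma e0 kappa12 Del0
    rho0 L0 Lf0 Lphi0 sigma0 ex0 eC.
  rewrite -epsE opprB addrCA subrr addr0 => cb.
  have : 0 <= 10 * 20 ^+ 8 * (gap Phi h x0 y0 * (rho / eps ^+ 2)).
    apply: mulr_ge0; first by rewrite mulr_ge0.
    by apply: mulr_ge0 => //; rewrite divr_ge0 ?sqr_ge0// ltW.
  move: KT cb; rewrite (mulrDr (10 * 20 ^+ 8)); lra.
have [k kK kd] := pigeonhole_sum K0 Ksum.
have AE : 20 / kappa * eps = 20 * e by rewrite /e; field; rewrite gt_eqF.
rewrite AE big_add1 /= big_mkord.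
apply: (le_trans (bigmin_le _ (Ordinal kK) _)) => /=.
rewrite unlock; have [xm _] := measurable_xy MP SP k.+1.
have gE w : enorm (grad_moreau (1 / (2 * rho)) (primal Phi f h) (x k.+1 w)) =
    2 * rho * enorm (x k.+1 w - prox_psi Phi f h rho (x k.+1 w)).
  by rewrite (grad_moreauE MP) enormZ gtr0_norm// mulr_gt0.
under eq_integral do rewrite gE.
apply: mean_le_of_mean_square; first by rewrite mulr_gt0.
- apply: measurable_funM => //; apply: measurable_fun_enormB => //.
  exact: (measurable_prox_psi MP).
- by move=> w; rewrite !mulr_ge0 ?enorm_ge0// ltW.
have dE w : (2 * rho * enorm (x k.+1 w - prox_psi Phi f h rho (x k.+1 w))) ^+ 2 =
    4 * (rho ^+ 2 * enorm (prox_psi Phi f h rho (x k.+1 w) - x k.+1 w) ^+ 2).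
  by rewrite enormB; ring.
under eq_integral do rewrite dE.
rewrite integral_EFinZ//; last 2 first.
- exact: (measurable_prox_psi_dist MP).
- by move=> w; rewrite mulr_ge0// sqr_ge0.
have -> : (20 * e) ^+ 2 = 4 * (100 * e ^+ 2) by ring.
by rewrite EFinM lee_wpmul2l.
Qed.
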